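(* Let $\mathbf X,\mathbf Y$ be finite dimensional Hilbert spaces, let $\varphi:\mathbf X\to\mathbb R$ and $\Phi:\mathbf X\to\mathbf Y$ be $\mathcal C^2$-smooth, and let $g:\mathbf Y\to[-\infty,\infty]$ be a convex function. Put $L(x,y)=\varphi(x)+\langle y,\Phi(x)\rangle$ and define $\Psi:\mathbf X\times\mathbf Y\rightrightarrows\mathbf X\times\mathbf Y$ by $$\Psi(x,y)=\begin{bmatrix}\nabla_xL(x,y)\\ -\Phi(x)\end{bmatrix}+\begin{bmatrix}0\\ \partial g^*(y)\end{bmatrix},$$ and $S_{KKT}:=\Psi^{-1}$. Assume that $(\bar x,\bar y)$ satisfies $0=\nabla_xL(\bar x,\bar y)$ and $\bar y\in\partial g(\Phi(\bar x))$, that $\bar y\in\mathrm{ri}\,\partial g(\bar u)$ with $\bar u:=\Phi(\bar x)$, and that $g$ is reliably $\mathcal C^2$-decomposable at every point of $\mathrm{dom}\,g$ in a neighborhood of $\bar u$; let $g(u')=g(\bar u)+\vartheta(\Xi(u'))$ be the corresponding representation around $\bar u$. Then the following properties are equivalent: (a) $\Psi$ is strongly metrically regular at $(\bar x,\bar y)$ for $(0,0)$; (b) $\Psi$ is metrically regular at $(\bar x,\bar y)$ for $(0,0)$; (c) $\Psi$ is strongly metrically subregular at $(\bar x,\bar y)$ for $(0,0)$; (d) the solution mapping $S_{KKT}$ has a Lipschitz continuous single-valued localization around $(0,0)$ for $(\bar x,\bar y)$, which is $\mathcal C^1$ in a neighborhood of $(0,0)$; (e) the implication $$\begin{cases}\nabla^2_{xx}L(\bar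 x,\bar y)w-\nabla\Phi(\bar x)^*w'=0,\\ \nabla\Phi(\bar x)w\in K_g(\bar u,\bar y),\\ w'+\nabla^2\langle\bar\mu,\Xi\rangle(\bar u)(\nabla\Phi(\bar x)w)\in K_g(\bar u,\bar y)^\perp\end{cases}\implies(w,w')=(0,0)$$ holds, where $\bar\mu$ is the unique element of the set $M(\bar u,\bar y)=\{\mu\mid\nabla\Xi(\bar u)^*\mu=\bar y,\ \mu\in\partial\vartheta(\Xi(\bar u))\}$.
   Context: $g^*$ is the Fenchel conjugate of $g$; for convex functions $\partial$ is the subdifferential of convex analysis; $\mathrm{ri}$ is relative interior; $\mathrm{dom}\,g=\{u\mid g(u)<\infty\}$. The critical cone is $K_g(\bar u,\bar y)=\{w\in\mathbf Y\mid\langle\bar y,w\rangle=\mathrm dg(\bar u)(w)\}$ with the subderivative $\mathrm dg(\bar u)(w)=\liminf_{t\searrow0,\,w'\to w}\frac{g(\bar u+tw')-g(\bar u)}{t}$. $\nabla^2\langle\bar\mu,\Xi\rangle(\bar u)$ is the Hessian (as a linear operator on $\mathbf Y$) at $\bar u$ of $u\mapsto\langle\bar\mu,\Xi(u)\rangle$. $g$ is $\mathcal C^2$-decomposable at $u$ if $g(u)$ is finite and there are an open neighborhood $\mathcal O\subset\mathbf Y$ of $u$, a finite dimensional Hilbert space $\mathbf Z$, a proper, lower semicontinuous, sublinear function $\vartheta:\mathbf Z\to[-\infty,\infty]$ and a $\mathcal C^2$-smooth mapping $\Xi:\mathcal O\to\mathbf Z$ with $\Xi(u)=0$ such that $g(u')=g(u)+\vartheta(\Xi(u'))$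 for all $u'\in\mathcal O$. It is reliably $\mathcal C^2$-decomposable at $u$ if, in addition, the nondegeneracy condition $\mathrm{par}\{\partial\vartheta(\Xi(u))\}\cap\ker\nabla\Xi(u)^*=\{0\}$ holds, where $\mathrm{par}\,C$ is the linear subspace parallel to the affine hull of $C$. Under this condition $M(\bar u,\bar y)$ is a singleton. For a set-valued mapping $F$ and $\bar q\in F(\bar p)$: $F$ is metrically regular at $\bar p$ for $\bar q$ if there exist $\kappa>0$ and neighborhoods $U$ of $\bar p$, $V$ of $\bar q$ with $\mathrm{dist}(p,F^{-1}(q))\le\kappa\,\mathrm{dist}(q,F(p))$ for all $(p,q)\in U\times V$. $F^{-1}$ has a Lipschitz continuous single-valued localization around $\bar q$ for $\bar p$ if there are neighborhoods $U$ of $\bar p$ and $V$ of $\bar q$ such that $q\mapsto F^{-1}(q)\cap U$ is single-valued and Lipschitz continuous on $V$; in that case $F$ is called strongly metrically regular at $\bar p$ for $\bar q$. $F$ is strongly metrically subregular at $\bar p$ for $\bar q$ if there are $\ell\ge0$ and a neighborhood $U$ of $\bar p$ with $\|p-\bar p\|\le\ell\,\mathrm{dist}(\bar q,F(p))$ for all $p\in U$. *)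

(* Defs.v *)
From HB Require Import structures.
From mathcomp Require Import all_boot all_order all_algebra.
From mathcomp Require Import all_classical all_reals all_analysis.

Set Implicit Arguments.
Unset Strict Implicit.
Unset Printing Implicit Defensive.

Import Order.TTheory GRing.Theory Num.Theory.
Import numFieldNormedType.Exports.

Local Open Scope classical_set_scope.
Local Open Scope ring_scope.

(* A finite-dimensional real Hilbert space: the norm, hence the topology, is
   the one induced by the inner product; finite dimension is Vector. *)
HB.mixin Record isFinDimHilbert (R : realType) V
    of NormedModule R V & Vector R V := {
  inner : {dot V for (@idfun R)} ;
  sqr_norm_inner : forall v : V, `|v| ^+ 2 = inner v v
}.

#[short(type="finDimHilbertType")]
HB.structure Definition FinDimHilbert (R : realType) :=
  { V of NormedModule R V & Vector R V & isFinDimHilbert R V }.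

Section Smoothness.
Context {R : realType}.

(* For O open. In finite dimension, continuity of x |-> 'd f x v for every
   vector v is continuity of the derivative for the operator norm. *)
Definition C1_on (V W : normedModType R) (O : set V) (f : V -> W) : Prop :=
  forall x, O x ->
    differentiable f x /\ forall v, {for x, continuous (fun z => 'd f z v)}.

Definition C2_on (V W : normedModType R) (O : set V) (f : V -> W) : Prop :=
  C1_on O f /\ forall v, C1_on O (fun x => 'd f x v).

Variables V W : finDimHilbertType R.

Definition riesz (l : V -> R) : V := get [set a | forall v, inner a v = l v].

Definition adjoint (A : V -> W) (w : W) : V := riesz (fun v => inner w (A v)).

Definition grad (f : V -> R) (x : V) : V := riesz ('d f x).

Definition hess (f : V -> R) (x : V) : V -> V := 'd (grad f) x.

End Smoothness.

Section ConvexAnalysis.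
Context {R : realType}.
Variable V : finDimHilbertType R.
Implicit Types (C : set V) (f : V -> \bar R).

Definition epigraph f : set (V * R) := [set p | (f p.1 <= p.2%:E)%E].

Definition convex_efun f : Prop := convex_set (epigraph f).

Definition edom f : set V := [set u | (f u < +oo)%E].

Definition proper_efun f : Prop :=
  (forall u, f u != -oo%E) /\ edom f !=set0.

(* The dual addition %dE has +oo + -oo = +oo, as subadditivity requires. *)
Definition sublinear f : Prop :=
  [/\ edom f 0,
      forall (t : R) z, 0 < t -> f (t *: z) = (t%:E * f z)%E
    & forall z z', (f (z + z')%R <= (f z + f z')%dE)%E].

(* Empty at points where f is not finite. *)
Definition subdifferential f (u : V) : set V :=
  [set y | f u \is a fin_num /\
           forall v, (f u + (inner y (v - u))%:E <= f v)%E].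

Definition conjugate f (y : V) : \bar R :=
  ereal_sup [set ((inner y u)%:E - f u)%E | u in [set: V]].

Definition affine_hull C : set V :=
  [set v | exists n (c : 'I_n -> V) (t : 'I_n -> R),
     [/\ forall i, C (c i), \sum_i t i = 1 & v = \sum_i t i *: c i]].

Definition parallel_subspace C : set V :=
  [set a - b | a in affine_hull C & b in affine_hull C].

Definition relative_interior C : set V :=
  [set y | C y /\ \forall z \near y, affine_hull C z -> C z].

Definition orthogonal_complement C : set V :=
  [set v | forall w, C w -> inner v w = 0].

(* The lower limit is along t -> 0+ and w' -> w jointly. *)
Definition subderivative f (u w : V) : \bar R :=
  limf_einf
    (fun p : R * V => ((f (u + p.1 *: p.2)%R - f u) * (p.1^-1)%:E)%E)
    (filter_prod 0^'+ (nbhs w)).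

Definition critical_cone f (u y : V) : set V :=
  [set w | (inner y w)%:E = subderivative f u w].

End ConvexAnalysis.

Section Decomposability.
Context {R : realType}.
Variable Y : finDimHilbertType R.

(* Xi is total but only its restriction to O matters. *)
Record C2_decomposition (Z : finDimHilbertType R) (g : Y -> \bar R) (u : Y)
    (O : set Y) (theta : Z -> \bar R) (Xi : Y -> Z) : Prop := {
  decomp_fin_num : g u \is a fin_num ;
  decomp_open : open O ;
  decomp_mem : O u ;
  decomp_proper : proper_efun theta ;
  decomp_lsc : lower_semicontinuous theta ;
  decomp_sublinear : sublinear theta ;
  decomp_C2 : C2_on O Xi ;
  decomp_eq0 : Xi u = 0 ;
  decomp_eq : forall u', O u' -> g u' = (g u + theta (Xi u'))%E
}.

Definition nondegenerate_at (Z : finDimHilbertType R) (u : Y)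
    (theta : Z -> \bar R) (Xi : Y -> Z) : Prop :=
  parallel_subspace (subdifferential theta (Xi u))
    `&` [set mu | adjoint ('d Xi u) mu = 0] = [set 0].

Definition reliably_C2_decomposable (g : Y -> \bar R) (u : Y) : Prop :=
  exists (Z : finDimHilbertType R) (O : set Y)
         (theta : Z -> \bar R) (Xi : Y -> Z),
    C2_decomposition g u O theta Xi /\ nondegenerate_at u theta Xi.

Definition multipliers (Z : finDimHilbertType R) (theta : Z -> \bar R)
    (Xi : Y -> Z) (u y : Y) : set Z :=
  [set mu | adjoint ('d Xi u) mu = y /\ subdifferential theta (Xi u) mu].

End Decomposability.

Section SetValued.
Context {R : realType}.

Definition set_inverse (P Q : Type) (F : P -> set Q) : Q -> set P :=
  fun q => [set p | F p q].

Variables P Q : normedModType R.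
Implicit Types (F : P -> set Q) (p : P) (q : Q).

(* edist_inf A x is the distance from x to A, equal to +oo if A is empty. *)
Definition metrically_regular F p0 q0 : Prop :=
  exists kappa : R, exists U V, [/\ 0 < kappa, nbhs p0 U, nbhs q0 V
    & forall p q, U p -> V q ->
        (edist_inf (set_inverse F q) p <= kappa%:E * edist_inf (F p) q)%E].

Definition lipschitz_localization (S : Q -> set P) q0 p0 (s : Q -> P) : Prop :=
  exists U V, [/\ nbhs p0 U, nbhs q0 V,
    forall q, V q -> S q `&` U = [set s q] & [lipschitz s q | q in V]].

Definition strongly_metrically_regular F p0 q0 : Prop :=
  exists s, lipschitz_localization (set_inverse F) q0 p0 s.

Definition strongly_metrically_subregular F p0 q0 : Prop :=
  exists ell : R, exists U, [/\ 0 <= ell, nbhs p0 U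
    & forall p, U p -> (`|p - p0|%:E <= ell%:E * edist_inf (F p) q0)%E].

End SetValued.

Section KKT.
Context {R : realType}.
Variables (X Y : finDimHilbertType R).
Variables (phi : X -> R) (Phi : X -> Y) (g : Y -> \bar R).

Definition lagrangian (y : Y) (x : X) : R := phi x + inner y (Phi x).

Definition KKT_map (p : X * Y) : set (X * Y) :=
  [set (grad (lagrangian p.2) p.1, - Phi p.1 + v)
     | v in subdifferential (conjugate g) p.2].

Definition S_KKT : X * Y -> set (X * Y) := set_inverse KKT_map.

End KKT.

(* Main.v *)
Require Import Defs.
From HB Require Import structures.
From mathcomp Require Import all_boot all_order all_algebra.
From mathcomp Require Import all_classical all_reals all_analysis.
From mathcomp Require Import ring lra.

Set Implicit Arguments.
Unset Strict Implicit.
Unset Printing Implicit Defensive.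

Import Order.TTheory GRing.Theory Num.Theory.
Import numFieldNormedType.Exports.

Local Open Scope classical_set_scope.
Local Open Scope ring_scope.

(** Write B for the derivative of Xi at ubar, C for the subdifferential of theta
    at 0 and L for the subspace parallel to C.  Nondegeneracy says that the
    adjoint B^* is injective on L; hence mubar is unique, and the orthogonal
    projection P on L makes P B surjective onto L.

    The decomposition turns the graph of the subdifferential of g near
    (ubar, ybar) into a C1 manifold of the dimension of Y.  A lower
    semicontinuous sublinear function is linear on the orthogonal of L
    (sublinear_lineality), so wherever P (Xi u) = 0 every mu in C is a subgradient
    of theta at Xi u, and Xi'(u)^* mu is one of g at u (subgradient_of_multiplier).
    Because ybar is relatively interior, the vectors mubar + lambda with lambda
    small in L all belong to C (multiplier_interior).  The system P (Xi u) = 0,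
    rho u + Xi'(u)^* (mubar + lambda) = q has, for rho large, an injective
    derivative in (u, lambda), and the inverse function theorem solves it by a C1
    map U with U q = u: this U is a proximal map of g (local_prox).  That the
    manifold exhausts the graph of the subdifferential of the conjugate of g near
    (ybar, ubar) follows from monotonicity alone, since rho u + y determines the
    pair (u, y) (conjugate_prox).

    Therefore the graph of Psi near the reference point is the image of the C1
    map (x, q) |-> (kkt_point, kkt_residual).  The space of parameters has the
    dimension of X * Y, so Psi behaves like the smooth square system
    kkt_residual (x, q) = v.  If its derivative is injective, the inverse
    function theorem gives the C1 localization of the solution mapping, which
    implies strong regularity and with it the other two notions.  Conversely,
    subregularity rules out kernel directions, and regularity makes the
    derivative surjective (subregular_injective_derivative,
    regular_injective_derivative).

    What remains is linear algebra.  The critical cone is the kernel of P B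
    (critical_coneP): below, every subgradient minorizes the subderivative, and
    ybar, being relatively interior, is dominated by another subgradient in any
    direction w with P (B w) <> 0; above, Xi'(ubar) w is realized along curves on
    which P (Xi u) = 0 (tangent_points).  The orthogonal complement of the cone is
    the range of B^* P (normal_of_kernel).  With the derivative of U from
    local_prox, the kernel of the derivative of kkt_residual is exactly the
    solution set of the system in the implication on (w, w'). *)

(** * Inner products *)

Section InnerProduct.
Context {R : realType} {V : finDimHilbertType R}.
Implicit Types (a : R) (x y z : V).

Lemma innerC x y : inner x y = inner y x.
Proof. by have := hermC (inner : {dot V for idfun}) x y; rewrite expr0 mul1r. Qed.

Lemma innerDl x y z : inner (x + y) z = inner x z + inner y z.
Proof. exact: linearDl. Qed.

Lemma innerDr x y z : inner z (x + y) = inner z x + inner z y.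
Proof. exact: linearD. Qed.

Lemma innerZl a y z : inner (a *: y) z = a * inner y z.
Proof. exact: linearZl_LR. Qed.

Lemma innerZr a y z : inner z (a *: y) = a * inner z y.
Proof. exact: linearZ. Qed.

Lemma innerNl y z : inner (- y) z = - inner y z.
Proof. by rewrite -scaleN1r innerZl mulN1r. Qed.

Lemma innerNr y z : inner z (- y) = - inner z y.
Proof. by rewrite innerC innerNl innerC. Qed.

Lemma inner0l z : inner 0 z = 0.
Proof. by rewrite -(scale0r 0) innerZl mul0r. Qed.

Lemma inner0r z : inner z 0 = 0.
Proof. by rewrite innerC inner0l. Qed.

Lemma innerBl x y z : inner (x - y) z = inner x z - inner y z.
Proof. by rewrite innerDl innerNl. Qed.

Lemma innerBr x y z : inner z (x - y) = inner z x - inner z y.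
Proof. by rewrite innerDr innerNr. Qed.

Lemma inner_sumr n (f : 'I_n -> V) z :
  inner z (\sum_i f i) = \sum_i inner z (f i).
Proof. exact: linear_sum. Qed.

Lemma inner_suml n (f : 'I_n -> V) z :
  inner (\sum_i f i) z = \sum_i inner (f i) z.
Proof. by rewrite innerC inner_sumr; apply: eq_bigr => i _; rewrite innerC. Qed.

Lemma innerxx x : inner x x = `|x| ^+ 2.
Proof. by rewrite -sqr_norm_inner. Qed.

Lemma inner_ge0 x : 0 <= inner x x.
Proof. by rewrite innerxx sqr_ge0. Qed.

Lemma inner_eq0 x : inner x x = 0 -> x = 0.
Proof. by move/eqP; rewrite innerxx sqrf_eq0 normr_eq0 => /eqP. Qed.

Lemma inner_inj x y : (forall z, inner x z = inner y z) -> x = y.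
Proof.
by move=> xy; apply/eqP; rewrite -subr_eq0; apply/eqP/inner_eq0; rewrite innerBl xy subrr.
Qed.

Lemma cauchy_schwarz x y : `|inner x y| <= `|x| * `|y|.
Proof.
have [->|y0] := eqVneq y 0; first by rewrite inner0r !normr0 mulr0.
have yy : 0 < inner y y by rewrite innerxx exprn_gt0 ?normr_gt0.
have := inner_ge0 (inner y y *: x - inner x y *: y).
rewrite innerBl !innerBr !innerZl !innerZr (innerC y x) => h.
have {}h : 0 <= inner y y * (inner x x * inner y y - inner x y ^+ 2) by lra.
move: h; rewrite pmulr_rge0// subr_ge0 !innerxx -exprMn => h.
by rewrite -ler_sqr ?nnegrE ?mulr_ge0// real_normK// num_real.
Qed.

Lemma inner_le x y : inner x y <= `|x| * `|y|.
Proof. exact: le_trans (ler_norm _) (cauchy_schwarz x y). Qed.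

Lemma norm_le_inner x (M : R) : 0 <= M -> inner x x <= M * `|x| -> `|x| <= M.
Proof.
move=> M0; rewrite innerxx expr2; have [->|x0] := eqVneq x 0; first by rewrite normr0.
by rewrite ler_pM2r// normr_gt0.
Qed.

End InnerProduct.

(** * Orthonormal families *)

Section Orthonormal.
Context {R : realType} {V : finDimHilbertType R}.

Definition linear_subspace (L : set V) : Prop :=
  L 0 /\ forall (a : R) x y, L x -> L y -> L (a *: x + y).

Definition orthonormal_family n (e : 'I_n -> V) : Prop :=
  forall i j, inner (e i) (e j) = (i == j)%:R.

(** The orthogonal projection on the span of e when e is orthonormal. *)
Definition orthogonal_projection n (e : 'I_n -> V) (v : V) : V :=
  \sum_i inner (e i) v *: e i.

Lemma orthonormal_coord n (e : 'I_n -> V) (c : 'I_n -> R) i :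
  orthonormal_family e -> inner (e i) (\sum_j c j *: e j) = c i.
Proof.
move=> oe; rewrite inner_sumr (bigD1 i)//= innerZr oe eqxx mulr1 big1 ?addr0// => j ji.
by rewrite innerZr oe eq_sym (negPf ji) mulr0.
Qed.

Lemma subspace_sum (L : set V) n (c : 'I_n -> R) (e : 'I_n -> V) :
  linear_subspace L -> (forall i, L (e i)) -> L (\sum_i c i *: e i).
Proof.
move=> [L0 LD] Le; elim/big_ind : _ => // [x y Lx Ly|i _].
  by rewrite -(scale1r x); apply: LD.
by rewrite -(addr0 (_ *: _)); apply: LD.
Qed.

Lemma orthonormal_size n (e : 'I_n -> V) :
  orthonormal_family e -> (n <= \dim (fullv : {vspace V}))%N.
Proof.
move=> oe; pose X := [tuple e i | i < n].
have /eqP dX : free X.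
  apply/freeP => k; under eq_bigr do rewrite -tnth_nth tnth_mktuple.
  by move=> k0 i; rewrite -(orthonormal_coord k i oe) k0 inner0r.
rewrite -(size_tuple X) -dX; exact/dimvS/subvf.
Qed.

(** A maximal orthonormal family in L spans it: the component of a vector of
    L orthogonal to the family could otherwise be normalized and added. *)
Lemma orthonormal_basis (L : set V) : linear_subspace L ->
  exists n (e : 'I_n -> V), [/\ orthonormal_family e, forall i, L (e i)
    & forall v, L v -> orthogonal_projection e v = v].
Proof.
move=> sL.
pose P n := `[< exists e : 'I_n -> V, orthonormal_family e /\ forall i, L (e i) >].
have P0 : exists n, P n.
  by exists 0%N; apply/asboolP; exists (fun _ => 0); split=> -[].
have Pb n : P n -> (n <= \dim (fullv : {vspace V}))%N.
  by case/asboolP => e [/orthonormal_size].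
have [n /asboolP[e [oe Le]] maxn] := ex_maxnP P0 Pb.
exists n, e; split=> // v Lv; apply/eqP; rewrite eq_sym -subr_eq0; apply/negPn/negP.
set w := v - _ => w0.
have Lw : L w.
  rewrite /w addrC -scaleN1r; apply sL.2 => //; exact: subspace_sum.
have we i : inner (e i) w = 0.
  by rewrite innerBr (orthonormal_coord (fun j => inner (e j) v))// subrr.
suff : P n.+1 by move/maxn; rewrite ltnn.
apply/asboolP; pose w1 := `|w|^-1 *: w.
have w1e i : inner (e i) w1 = 0 by rewrite innerZr we mulr0.
exists (fun i => if unlift ord_max i is Some j then e j else w1); split=> [i j|i].
  case: (unliftP ord_max i) => [i'|] ->; case: (unliftP ord_max j) => [j'|] ->.
  - by rewrite oe (inj_eq lift_inj).
  - by rewrite w1e eq_sym (negPf (neq_lift _ _)).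
  - by rewrite innerC w1e (negPf (neq_lift _ _)).
  - by rewrite eqxx innerZl innerZr innerxx expr2 mulrA mulrC mulrA mulfK ?mulfV ?normr_eq0.
case: (unliftP ord_max i) => [i'|] _ //.
by rewrite -(addr0 w1); apply: sL.2 => //; case: sL.
Qed.

End Orthonormal.

(** * Adjoints *)

Section Adjoint.
Context {R : realType}.
Implicit Types V W : finDimHilbertType R.

Lemma setT_subspace V : linear_subspace [set: V].
Proof. by []. Qed.

Lemma linear_expansion V (W : lmodType R) n (e : 'I_n -> V) (f : {linear V -> W}) v :
  orthogonal_projection e v = v -> f v = \sum_i inner (e i) v *: f (e i).
Proof.
by move=> {1}<-; rewrite linear_sum; apply: eq_bigr => i _; rewrite linearZ.
Qed.

Lemma rieszP V (f : {linear V -> R}) v : inner (riesz f) v = f v.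
Proof.
have [n [e [oe _ be]]] := orthonormal_basis (@setT_subspace V).
suff : [set a | forall v, inner a v = f v] (riesz f) by exact.
apply: (@getPex _ [set a | forall v, inner a v = f v]).
exists (\sum_i f (e i) *: e i) => u.
rewrite (@linear_expansion V R^o n e f u) ?be// inner_suml.
by apply: eq_bigr => i _; rewrite innerZl mulrC.
Qed.

Lemma adjointP V W (A : {linear V -> W}) w v : inner (adjoint A w) v = inner w (A v).
Proof. exact: (rieszP (inner w \o A)). Qed.

Lemma adjoint_expansion V W n (e : 'I_n -> V) (A : {linear V -> W}) w :
  (forall v, orthogonal_projection e v = v) ->
  adjoint A w = \sum_i inner w (A (e i)) *: e i.
Proof.
move=> be; apply: inner_inj => v; rewrite adjointP inner_suml.
rewrite (linear_expansion A (be v)) inner_sumr; apply: eq_bigr => i _.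
by rewrite innerZr innerZl mulrC.
Qed.

Lemma adjoint_is_linear V W (A : {linear V -> W}) : linear (adjoint A).
Proof.
move=> a x y; apply: inner_inj => v.
by rewrite adjointP !innerDl !innerZl !adjointP.
Qed.

HB.instance Definition _ V W (A : {linear V -> W}) :=
  GRing.isLinear.Build R W V _ (adjoint A) (adjoint_is_linear A).

Lemma orthogonal_projection_is_linear V n (e : 'I_n -> V) :
  linear (orthogonal_projection e).
Proof.
move=> a x y; rewrite /orthogonal_projection scaler_sumr -big_split/=.
by apply: eq_bigr => i _; rewrite innerDr innerZr scalerDl scalerA.
Qed.

HB.instance Definition _ V n (e : 'I_n -> V) :=
  GRing.isLinear.Build R V V _ (orthogonal_projection e)
    (orthogonal_projection_is_linear e).

Lemma inner_projection V n (e : 'I_n -> V) x y :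
  inner (orthogonal_projection e x) y = inner x (orthogonal_projection e y).
Proof.
rewrite inner_suml inner_sumr; apply: eq_bigr => i _.
by rewrite innerZl innerZr mulrC (innerC x).
Qed.

Lemma range_subspace V W (f : {linear V -> W}) :
  linear_subspace (range f).
Proof.
split; first by exists 0 => //; rewrite linear0.
by move=> a _ _ [x _ <-] [y _ <-]; exists (a *: x + y) => //; rewrite linearP.
Qed.

(** The image of x is the orthogonal projection of v on the range of f. *)
Lemma range_orthogonal V W (f : {linear V -> W}) v :
  exists x, forall y, inner (v - f x) (f y) = 0.
Proof.
have [m [d [od dr bd]]] := orthonormal_basis (range_subspace f).
have [x _ fx] := subspace_sum (fun i => inner (d i) v) (range_subspace f) dr.
exists x => y; have pv : f x = orthogonal_projection d v by exact: fx.
have fy : range f (f y) by exists y.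
have rv : range f (orthogonal_projection d v) by exists x.
by rewrite pv -(bd _ fy) -inner_projection linearB/= (bd _ rv) subrr inner0l.
Qed.

End Adjoint.

(** * Finite-dimensional normed spaces *)

Definition linear_pack (R : realType) (V W : normedModType R) (f : V -> W)
    (lf : linear f) : {linear V -> W} :=
  HB.pack f (GRing.isLinear.Build _ _ _ _ f lf).

Section RowVectors.
Context {R : realType}.

Lemma ler_coord n (v : 'rV[R]_n) i : `|v 0 i| <= `|v|.
Proof.
rewrite [leRHS]mx_normrE.
exact: (le_bigmax _ (fun ij : 'I_1 * 'I_n => `|v ij.1 ij.2|) (0, i)).
Qed.

Lemma rV_norm_le n (v : 'rV[R]_n) M : 0 <= M -> (forall i, `|v 0 i| <= M) -> `|v| <= M.
Proof.
by move=> M0 h; rewrite [leLHS]mx_normrE; apply: bigmax_le => // -[i j] _ /=; rewrite ord1.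
Qed.

Lemma rV_linear_le n (W : normedModType R) (f : {linear 'rV[R]_n -> W}) v :
  `|f v| <= (\sum_i `|f (delta_mx 0 i)|) * `|v|.
Proof.
rewrite {1}(row_sum_delta v) linear_sum (le_trans (ler_norm_sum _ _ _))// mulr_suml.
apply: ler_sum => i _; rewrite linearZ normrZ mulrC ler_wpM2l ?normr_ge0//.
exact: ler_coord.
Qed.

Lemma linear_le_continuous (V W : normedModType R) (f : {linear V -> W}) (M : R) :
  (forall v, `|f v| <= M * `|v|) -> continuous f.
Proof.
move=> fM; apply: continuousfor0_continuous; apply/cvgrPdist_lt => e e0 /=.
have M1 : 0 < `|M| + 1 by rewrite ltr_wpDl ?normr_ge0.
near=> v; rewrite linear0 sub0r normrN (le_lt_trans (fM v))//.
rewrite (@le_lt_trans _ _ ((`|M| + 1) * `|v|))//.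
  by rewrite ler_wpM2r ?normr_ge0// (le_trans (ler_norm _))// lerDl.
rewrite mulrC -ltr_pdivlMr//; near: v; apply: nbhs0_lt; exact: divr_gt0.
Unshelve. all: by end_near. Qed.

Lemma rV_linear_continuous n (W : normedModType R) (f : {linear 'rV[R]_n -> W}) :
  continuous f.
Proof. exact: linear_le_continuous (rV_linear_le f). Qed.

End RowVectors.

(** A linear homeomorphism with a space of row vectors: it passes to products,
    and transports completeness and matrix inversion to E. *)
Definition finite_dimensional (R : realType) (E : normedModType R) : Prop :=
  exists n (f : {linear E -> 'rV[R]_n}) (g : {linear 'rV[R]_n -> E}),
    [/\ continuous f, continuous g, cancel f g & cancel g f].

Section FiniteDimensional.
Context {R : realType}.
Implicit Types E W : normedModType R.

Lemma hilbert_finite_dimensional (V : finDimHilbertType R) : finite_dimensional V.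
Proof.
have [n [e [oe _ be]]] := orthonormal_basis (@setT_subspace _ V).
pose f v : 'rV[R]_n := \row_i inner (e i) v.
pose g (r : 'rV[R]_n) := \sum_i r 0 i *: e i.
have fl : linear f.
  by move=> a x y; apply/rowP => i; rewrite !mxE innerDr innerZr.
have gl : linear g.
  move=> a x y; rewrite scaler_sumr -big_split/=.
  by apply: eq_bigr => i _; rewrite !mxE scalerDl scalerA.
pose F := linear_pack fl.
pose G := linear_pack gl.
exists n, F, G; split.
- apply: (@linear_le_continuous _ _ _ F 1) => v; rewrite mul1r.
  apply: rV_norm_le => // i; rewrite mxE (le_trans (cauchy_schwarz _ _))//.
  rewrite -[leRHS]mul1r ler_wpM2r// -(@expr_le1 _ 2)//.
  by rewrite -innerxx oe eqxx.
- exact: rV_linear_continuous.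
- move=> v; rewrite /= -[RHS]be//; apply: eq_bigr => i _; by rewrite mxE.
- by move=> r; apply/rowP => i; rewrite mxE (orthonormal_coord (fun i => r 0 i)).
Qed.

Lemma real_finite_dimensional : finite_dimensional R.
Proof.
have fl : linear (fun r : R => const_mx r : 'rV[R]_1).
  by move=> a x y; apply/rowP => i; rewrite !mxE.
have gl : linear (fun v : 'rV[R]_1 => v 0 0) by move=> a x y; rewrite /= !mxE.
exists 1%N, (linear_pack fl), (linear_pack gl); split.
- apply: (@linear_le_continuous _ _ _ (linear_pack fl) 1) => v; rewrite mul1r.
  by apply: rV_norm_le => // i; rewrite mxE.
- exact: rV_linear_continuous.
- by move=> r; rewrite /= mxE.
- by move=> v; apply/rowP => i; rewrite mxE ord1.
Qed.

Lemma fst_norm_le E W (p : E * W) : `|p.1| <= `|p|.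
Proof. by rewrite prod_normE le_max lexx. Qed.

Lemma prod_finite_dimensional E W :
  finite_dimensional E -> finite_dimensional W -> finite_dimensional (E * W)%type.
Proof.
move=> [n [f [g [fc gc fg gf]]]] [m [h [k [hc kc hk kh]]]].
pose a (p : E * W) : 'rV[R]_(n + m) := row_mx (f p.1) (h p.2).
pose b (r : 'rV[R]_(n + m)) : E * W := (g (lsubmx r), k (rsubmx r)).
have al : linear a.
  by move=> c x y; rewrite /a scale_row_mx add_row_mx /= !linearP.
have bl : linear b.
  by move=> c x y; rewrite /b !linearP.
pose F := linear_pack al.
pose G := linear_pack bl.
exists (n + m)%N, F, G; split.
- have [C C0 fC] := linear_lipschitz fc; have [D D0 hD] := linear_lipschitz hc.
  apply: (@linear_le_continuous _ _ _ F (C + D)) => -[x y] /=.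
  have CD : 0 <= C + D by rewrite addr_ge0// ltW.
  apply: rV_norm_le => [|i]; first by rewrite mulr_ge0.
  rewrite mxE; case: (fintype.split i) => j; rewrite (le_trans (ler_coord _ _))//.
    apply: (le_trans (fC _)); apply: ler_pM; rewrite ?normr_ge0 ?(ltW C0)//.
      by rewrite lerDl ltW.
    exact: (fst_norm_le (x, y)).
  apply: (le_trans (hD _)); apply: ler_pM; rewrite ?normr_ge0 ?(ltW D0)//.
    by rewrite lerDr ltW.
  by rewrite prod_normE/= le_max lexx orbT.
- exact: rV_linear_continuous.
- by move=> [x y]; rewrite /= /b/a /= row_mxKl row_mxKr fg hk.
- by move=> r; rewrite /= /b/a /= gf kh hsubmxK.
Qed.

Lemma fd_linear_continuous E W (f : {linear E -> W}) :
  finite_dimensional E -> continuous f.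
Proof.
move=> [n [c [d [cc dc cd dcK]]]].
have [C C0 hC] := linear_lipschitz cc.
apply: (@linear_le_continuous _ _ _ f ((\sum_i `|(f \o d) (delta_mx 0 i)|) * C)) => v.
rewrite -{1}(cd v) (le_trans (rV_linear_le (f \o d) (c v)))//.
by rewrite -mulrA ler_wpM2l ?sumr_ge0.
Qed.

Lemma fd_linear_bounded E W (f : {linear E -> W}) :
  finite_dimensional E -> exists2 M : R, 0 < M & forall v, `|f v| <= M * `|v|.
Proof. by move=> Efd; apply: linear_lipschitz; apply: fd_linear_continuous. Qed.

Lemma rV_linear_inverse n (f : {linear 'rV[R]_n -> 'rV[R]_n}) :
  (forall v, f v = 0 -> v = 0) ->
  exists g : {linear 'rV[R]_n -> 'rV[R]_n}, cancel f g /\ cancel g f.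
Proof.
move=> f0; have uA : lin1_mx f \in unitmx.
  rewrite -row_free_unit; apply: inj_row_free => v; rewrite mul_rV_lin1; exact: f0.
exists (mulmxr (invmx (lin1_mx f))); split=> v /=.
  by rewrite -mul_rV_lin1 mulmxK.
by rewrite -mul_rV_lin1 mulmxKV.
Qed.

Lemma fd_linear_inverse E (f : {linear E -> E}) : finite_dimensional E ->
  (forall v, f v = 0 -> v = 0) ->
  exists g : {linear E -> E}, cancel f g /\ cancel g f.
Proof.
move=> [n [c [d [_ _ cd dK]]]] f0.
have [|g [hg gh]] := @rV_linear_inverse n (c \o f \o d).
  by move=> v /= /(congr1 d); rewrite cd linear0 => /f0/(congr1 c); rewrite dK linear0.
exists (d \o g \o c); split=> v /=; first by have := hg (c v); rewrite /= cd => ->.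
by rewrite -[LHS]cd -[c (f _)]/((c \o f \o d) (g (c v))) gh cd.
Qed.

(** If the range were not everything, some nonzero functional would vanish on
    it, hence on its closure. *)
Lemma fd_dense_range_injective E (f : {linear E -> E}) : finite_dimensional E ->
  (forall v (eps : R), 0 < eps -> exists h, `|v - f h| <= eps) ->
  forall v, f v = 0 -> v = 0.
Proof.
move=> [n [c [d [cc _ cd dcK]]]] dense.
pose h := c \o f \o d : {linear 'rV[R]_n -> 'rV[R]_n}.
have [hu|] := boolP (lin1_mx h \in unitmx).
  move=> v fv0; have : c v *m lin1_mx h = 0 by rewrite mul_rV_lin1 /= cd fv0 linear0.
  move/(congr1 (mulmxr (invmx (lin1_mx h)))); rewrite /= mulmxK// mul0mx => cv0.
  by rewrite -(cd v) cv0 linear0.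
rewrite -unitmx_tr -row_free_unit => nfree.
have [r r0 rh] : exists2 r : 'rV[R]_n, r != 0 & r *m (lin1_mx h)^T = 0.
  apply: contrapT => nr; move/negP: nfree; apply; apply: inj_row_free => r rh.
  by apply/eqP/negPn/negP => r0; apply: nr; exists r.
pose l v : R := (c v *m r^T) 0 0.
have [C C0 hC] := linear_lipschitz cc.
have lf v : l (f v) = 0.
  rewrite /l -(cd v) -[c (f (d _))]/(h (c v)) -mul_rV_lin1 -mulmxA.
  by rewrite -[_ *m r^T]trmxK trmx_mul trmxK rh trmx0 mulmx0 mxE.
have lB x y : l (x - y) = l x - l y by rewrite /l linearB mulmxBl !mxE.
have lb v : `|l v| <= (C * \sum_i `|r 0 i|) * `|v|.
  rewrite /l mxE (le_trans (ler_norm_sum _ _ _))// -mulrA mulrC -mulrA mulr_suml.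
  apply: ler_sum => i _; rewrite normrM mxE [leRHS]mulrC ler_wpM2r ?normr_ge0//.
  by rewrite mulrC (le_trans (ler_coord _ _)).
have l0 v : l v = 0.
  apply/eqP; rewrite -normr_le0; apply/ler_addgt0Pl => e e0; rewrite addr0.
  set M := C * _ in lb; have M0 : 0 <= M by rewrite mulr_ge0 ?sumr_ge0 ?ltW.
  have [|k vk] := dense v (e / (M + 1)); first by rewrite divr_gt0// ltr_wpDl.
  have -> : l v = l (v - f k) by rewrite lB lf subr0.
  rewrite (le_trans (lb _))// (@le_trans _ _ ((M + 1) * (e / (M + 1))))//.
    by rewrite ler_pM// lerDl.
  by rewrite mulrC divfK// gt_eqF// ltr_wpDl.
move: (l0 (d r)); rewrite /l dcK mxE => /eqP.
rewrite psumr_eq0; last by move=> i _; rewrite mxE -expr2 sqr_ge0.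
move/allP => rr0; exfalso; move/eqP: r0; apply; apply/rowP => i.
have := rr0 i (mem_index_enum i); rewrite /= !mxE -expr2 sqrf_eq0 => /eqP ->.
by [].
Qed.

End FiniteDimensional.

Arguments real_finite_dimensional : clear implicits.

(** * Continuously differentiable maps *)

Section Differentials.
Context {R : realType}.
Implicit Types U V W : normedModType R.

Lemma open_setX V W (A : set V) (B : set W) : open A -> open B -> open (A `*` B).
Proof.
move=> oA oB; rewrite openE => -[x y] [/= Ax By]; exists (A, B) => //=.
by split; exact: open_nbhs_nbhs.
Qed.

Lemma differentiableE V W (f : V -> W) (x : V) (eps : R) :
  differentiable f x -> 0 < eps ->
  \forall z \near x, `|f z - f x - 'd f x (z - x)| <= eps * `|z - x|.
Proof.
move=> /diff_locallyP[_ /eqaddoP df] e0; have := df _ e0.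
rewrite near_simpl /= => h; rewrite (near_shift 0 x) subr0 /=.
by apply: filterS h => y /=; rewrite /= addrK !fctE /= opprD addrA.
Qed.

Lemma is_diff_near V W (f : V -> W) (x : V) (A : {linear V -> W}) :
  continuous A ->
  (forall eps : R, 0 < eps ->
     \forall z \near x, `|f z - f x - A (z - x)| <= eps * `|z - x|) ->
  is_diff x f A.
Proof.
move=> cA fA.
have fo : f \o shift x = cst (f x) + A +o_ 0 id.
  apply/eqaddoP => e e0; have := fA _ e0.
  rewrite (near_shift 0 x) subr0 /= => h.
  by apply: filterS h => y /=; rewrite /= addrK !fctE /= opprD addrA.
have dA := diff_unique cA fo; apply: DiffDef => //.
by apply/diff_locallyP; rewrite dA; split.
Qed.

Lemma near_eq_is_diff V W (f g : V -> W) (x : V) :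
  (\forall z \near x, f z = g z) -> differentiable f x -> is_diff x g ('d f x).
Proof.
move=> fg df; apply: is_diff_near; first exact: diff_continuous.
move=> e e0; have fgx := nbhs_singleton fg.
by near=> z; rewrite -fgx -(near fg z)//; near: z; exact: differentiableE.
Unshelve. all: by end_near. Qed.

Lemma is_diff_near_eq V W (f g df : V -> W) (x : V) :
  (\forall z \near x, f z = g z) -> is_diff x f df -> is_diff x g df.
Proof.
by move=> fg [dfx <-]; exact: near_eq_is_diff.
Qed.

Lemma C1_onI V W (O : set V) (f : V -> W) (D : V -> {linear V -> W}) :
  open O -> (forall x, O x -> is_diff x f (D x)) ->
  (forall x, O x -> forall v, {for x, continuous (fun z => D z v)}) ->
  C1_on O f.
Proof.
move=> oO fD cD x Ox; split; first by case: (fD x Ox).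
move=> v; rewrite /prop_for /continuous_at.
have := cD x Ox v; rewrite /prop_for /continuous_at.
have -> : 'd f x v = D x v by case: (fD x Ox) => _ ->.
apply: cvg_trans; apply: near_eq_cvg.
near=> z; have Oz : O z by near: z; exact: open_nbhs_nbhs.
by case: (fD z Oz) => _ ->.
Unshelve. all: by end_near. Qed.

Lemma C1_on_sub V W (O O' : set V) (f : V -> W) : O `<=` O' -> C1_on O' f -> C1_on O f.
Proof. by move=> OO' h x /OO'; exact: h. Qed.

Lemma C1_on_eq V W (O : set V) (f g : V -> W) :
  open O -> (forall x, O x -> f x = g x) -> C1_on O f -> C1_on O g.
Proof.
move=> oO fg C1f; apply: (C1_onI (D := fun x => 'd f x : {linear V -> W}) oO) => x Ox.
  apply: near_eq_is_diff; last by case: (C1f x Ox).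
  by near=> z; apply: fg; near: z; exact: open_nbhs_nbhs.
by case: (C1f x Ox).
Unshelve. all: by end_near. Qed.

Lemma C1_on_diff V W (O : set V) (f : V -> W) x : C1_on O f -> O x -> differentiable f x.
Proof. by move=> h /h[]. Qed.

Lemma C1_on_cst V W (O : set V) (c : W) : open O -> C1_on O (fun=> c).
Proof.
move=> oO; apply: (@C1_onI _ _ _ _ (fun=> \0)) => // x Ox.
by move=> v; exact: cst_continuous.
Qed.

Lemma C1_on_linear V W (O : set V) (f : {linear V -> W}) :
  open O -> continuous f -> C1_on O f.
Proof.
move=> oO cf; apply: (@C1_onI _ _ _ _ (fun=> f)) => // x Ox.
  by apply: DiffDef; [exact: linear_differentiable|exact: diff_lin].
by move=> v; exact: cst_continuous.
Qed.

Lemma C1_on_pair U V W (O : set U) (f : U -> V) (g : U -> W) :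
  open O -> C1_on O f -> C1_on O g -> C1_on O (fun x => (f x, g x)).
Proof.
move=> oO C1f C1g.
have lD x : linear (fun v => ('d f x v, 'd g x v)).
  by move=> a u v; rewrite !linearP.
apply: (@C1_onI _ _ _ _ (fun x => linear_pack (lD x))) => // x Ox; last first.
  move=> v /=; apply: cvg_pair; [exact: (C1f x Ox).2|exact: (C1g x Ox).2].
have [[df _] [dg _]] := (C1f x Ox, C1g x Ox).
by apply: DiffDef; [exact: differentiable_pair|exact: diff_pair].
Qed.

Lemma C1_on_add V W (O : set V) (f g : V -> W) :
  open O -> C1_on O f -> C1_on O g -> C1_on O (fun x => f x + g x).
Proof.
move=> oO C1f C1g.
apply: (@C1_onI _ _ _ _ (fun x => 'd f x \+ 'd g x : {linear V -> W})) => // x Ox; last first.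
  by move=> v /=; apply: cvgD; [exact: (C1f x Ox).2|exact: (C1g x Ox).2].
have [[df _] [dg _]] := (C1f x Ox, C1g x Ox).
by apply: DiffDef; [exact: differentiableD|exact: diffD].
Qed.

Lemma C1_on_sum V W (O : set V) n (f : 'I_n -> V -> W) :
  open O -> (forall i, C1_on O (f i)) -> C1_on O (fun x => \sum_i f i x).
Proof.
move=> oO; elim: n f => [f _|n IH f C1f].
  by apply: C1_on_eq (C1_on_cst (0:W) oO) => // x _; rewrite big_ord0.
apply: (@C1_on_eq _ _ _ (fun x => f ord0 x + \sum_(i < n) f (lift ord0 i) x)) => //.
  by move=> x _; rewrite big_ord_recl.
by apply: C1_on_add => //; apply: IH.
Qed.

(** Strong continuity of the derivative, pointwise on vectors, is continuity in
    operator norm because finitely many vectors span the domain. *)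
Lemma C1_on_operator V W (O : set V) (f : V -> W) x (eps : R) :
  finite_dimensional V -> C1_on O f -> O x -> 0 < eps ->
  \forall z \near x, forall v, `|'d f z v - 'd f x v| <= eps * `|v|.
Proof.
move=> [n [c [d [cc _ cd dcK]]]] C1f Ox e0.
have [C C0 hC] := linear_lipschitz cc.
pose b i := d (delta_mx 0 i).
pose del := eps / (C * n.+1%:R).
have del0 : 0 < del by rewrite divr_gt0 ?mulr_gt0.
have : \forall z \near x, forall i, `|'d f z (b i) - 'd f x (b i)| <= del.
  apply: filter_forall => i.
  have := (C1f x Ox).2 (b i); rewrite /prop_for/continuous_at => /cvgrPdist_le/(_ _ del0).
  by apply: filterS => z; rewrite distrC.
apply: filterS => z h v.
pose T := ('d f z \- 'd f x) \o d : {linear 'rV[R]_n -> W}.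
have -> : 'd f z v - 'd f x v = T (c v) by rewrite /T /= cd.
rewrite (le_trans (rV_linear_le _ _))//.
rewrite (@le_trans _ _ ((n%:R * del) * (C * `|v|)))//.
  apply: ler_pM => //.
    by apply: sumr_ge0 => i _; exact: normr_ge0.
  rewrite mulr_natl -[n in _ *+ n]card_ord -sumr_const.
  by apply: ler_sum => i _; exact: h.
have C1 : C != 0 by rewrite gt_eqF.
have n1 : n.+1%:R != 0 :> R by rewrite pnatr_eq0.
have nn : n%:R * del * C = eps * (n%:R / n.+1%:R).
  rewrite /del; move: n1; set m : R := n.+1%:R => m0; field; exact/andP.
rewrite mulrA ler_wpM2r// nn ler_piMr ?(ltW e0)//.
by rewrite ler_pdivrMr// mul1r ler_nat.
Qed.

Lemma C1_on_comp U V W (O : set U) (O' : set V) (f : U -> V) (g : V -> W) :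
  finite_dimensional V -> open O -> C1_on O f -> C1_on O' g ->
  (forall x, O x -> O' (f x)) -> C1_on O (g \o f).
Proof.
move=> fdV oO C1f C1g ff'.
apply: (@C1_onI _ _ _ _ (fun x => 'd g (f x) \o 'd f x : {linear U -> W})) => // x Ox.
  have [[df _] [dg _]] := (C1f x Ox, C1g (f x) (ff' x Ox)).
  by apply: DiffDef; [exact: differentiable_comp|exact: diff_comp].
move=> v /=; have [df dfc] := C1f x Ox.
apply/cvgrPdist_le => e e0.
have [M M0 hM] := fd_linear_bounded ('d g (f x)) fdV.
pose k := `|'d f x v| + 1.
have k0 : 0 < k by rewrite ltr_wpDl.
have c1 : \forall z \near x, `|'d f z v| <= k.
  have := dfc v; rewrite /prop_for/continuous_at => /cvgrPdist_le/(_ _ ltr01).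
  apply: filterS => z h; rewrite /k addrC -lerBlDr (le_trans _ h)//.
  by rewrite distrC (le_trans _ (ler_dist_dist _ _))// ler_norm.
have c2 : \forall z \near x, `|'d f x v - 'd f z v| <= e / 2 / M.
  have := dfc v; rewrite /prop_for/continuous_at => /cvgrPdist_le; apply.
  by rewrite !divr_gt0.
have e2 : 0 < e / 2 / k by rewrite !divr_gt0.
have c3 := differentiable_continuous df (C1_on_operator fdV C1g (ff' x Ox) e2).
near=> z.
rewrite -(subrK ('d g (f x) ('d f z v)) ('d g (f x) _)) -linearB -addrA.
rewrite (le_trans (ler_normD _ _))// (splitr e); apply: lerD.
  rewrite (le_trans (hM _))// mulrC -ler_pdivlMr//; by near: z.
rewrite distrC; have h3 : forall v, `|'d g (f z) v - 'd g (f x) v| <= e / 2 / k * `|v|.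
  by near: z; exact: c3.
rewrite (le_trans (h3 _))// mulrC -ler_pdivlMr ?divr_gt0//.
rewrite invf_div mulrC mulfVK ?gt_eqF ?divr_gt0//; by near: z.
Unshelve. all: by end_near. Qed.

Lemma C1_on_mul U (O : set U) (f g : U -> R) :
  open O -> C1_on O f -> C1_on O g -> C1_on O (fun x => f x * g x).
Proof.
move=> oO C1f C1g.
pose D x : {linear U -> R} := f x \*: 'd g x \+ g x \*: 'd f x.
apply: (C1_onI (D := D) oO) => x Ox.
  have [[df _] [dg _]] := (C1f x Ox, C1g x Ox).
  by apply: DiffDef; [exact: differentiableM|exact: diffM].
have [[df dfc] [dg dgc]] := (C1f x Ox, C1g x Ox).
by move=> v /=; apply: cvgD; apply: cvgM;
  [exact: differentiable_continuous|exact: dgc|exact: differentiable_continuous|exact: dfc].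
Qed.

Lemma C1_on_inner U (V : finDimHilbertType R) (O : set U) (f g : U -> V) :
  open O -> C1_on O f -> C1_on O g -> C1_on O (fun x => inner (f x) (g x)).
Proof.
move=> oO C1f C1g.
have [n [e [oe _ be]]] := orthonormal_basis (@setT_subspace _ V).
have fdV := hilbert_finite_dimensional V.
apply: (@C1_on_eq _ _ _ (fun x => \sum_i inner (e i) (f x) * inner (e i) (g x))) => //.
  move=> x _; rewrite -[f x in RHS](be _ I) inner_suml; apply: eq_bigr => i _.
  by rewrite innerZl.
apply: C1_on_sum => // i; have lc : continuous (inner (e i)) by exact: fd_linear_continuous.
by apply: C1_on_mul => //; apply: (C1_on_comp (O' := setT) fdV) => //;
  apply: C1_on_linear => //; exact: openT.
Qed.

Lemma C1_on_linear_comp U V W (O : set U) (f : U -> V) (g : {linear V -> W}) :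
  finite_dimensional V -> open O -> C1_on O f -> C1_on O (fun x => g (f x)).
Proof.
move=> fdV oO C1f; apply: (C1_on_comp (O' := setT) fdV) => //.
by apply: C1_on_linear; [exact: openT|exact: fd_linear_continuous].
Qed.

End Differentials.

(** * Mean values and strict differentiability *)

Section MeanValue.
Context {R : realType}.
Implicit Types V W : normedModType R.

(** Composing with a functional g reduces the estimate to the mean value theorem
    for a real function of t on the segment from b to a. *)
Lemma mean_value V W (f : V -> W) (T : {linear V -> W}) (g : {linear W -> R}) a b (M : R) :
  continuous g ->
  (forall t : R, 0 <= t <= 1 -> let z := b + t *: (a - b) in
     differentiable f z /\ `|g ('d f z (a - b) - T (a - b))| <= M) ->
  `|g (f a - f b - T (a - b))| <= M.
Proof.
move=> cg h; set w := a - b.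
pose p (t : R) := b + t *: w.
pose psi (t : R) := g (f (p t)) - t * g (T w).
have dpsi (t : R) : 0 <= t <= 1 -> is_derive t 1 psi (g ('d f (p t) w - T w)).
  move=> t01; have [dft _] := h t t01.
  have dp : is_diff t p (fun s : R => s *: w).
    rewrite (_ : (fun _ => _) = (0 : R -> V) + (fun s => s *: w)); first exact: is_diffD.
    by apply/funext => s; rewrite !fctE add0r.
  have dfp : is_diff t (f \o p) ('d f (p t) \o (fun s : R => s *: w)).
    by apply: is_diff_comp => //; exact: DiffDef.
  have dg : is_diff (f (p t)) g g.
    by apply: DiffDef; [exact: linear_differentiable|exact: diff_lin].
  have dgfp : is_diff t (g \o (f \o p)) (g \o ('d f (p t) \o (fun s : R => s *: w))).
    exact: is_diff_comp.
  have d1 : is_derive t 1 (g \o (f \o p)) (g ('d f (p t) w)).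
    have dd := @ex_diff _ _ _ _ _ _ _ dgfp.
    apply: DeriveDef; first exact: diff_derivable.
    by rewrite deriveE// (@diff_val _ _ _ _ _ _ _ dgfp) /= scale1r.
  have d2 : is_derive t 1 (fun s : R => s * g (T w)) (g (T w)).
    have := is_deriveM (is_derive_id t 1) (is_derive_cst (g (T w)) t 1).
    by move/is_derive_eq; apply; rewrite scaler0 add0r /GRing.scale /= mulr1.
  apply: (is_derive_eq (is_deriveB d1 d2)). 
  by rewrite -(linearB g).
have [||c c01] := @MVT_segment _ psi (fun t => g ('d f (p t) w - T w)) 0 1 ler01.
- by move=> t; rewrite in_itv/= => /andP[t0 t1]; apply: dpsi; rewrite (ltW t0) (ltW t1).
- apply: derivable_within_continuous => t; rewrite in_itv/= => t01.
  by case: (dpsi t t01).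
have [_ hM] := h c c01.
have bw : b + w = a by rewrite addrC subrK.
rewrite /psi /p scale1r scale0r addr0 bw mul1r mul0r subr0 subr0 mulr1 => eq1.
have -> : g (f a - f b - T w) = g ('d f (b + c *: w) w - T w) by rewrite -eq1 !linearB/= addrAC.
by [].
Qed.

(** Each coordinate of f in a chart of W is controlled along the segment by
    mean_value; the constant del absorbs the norms C and D of the chart. *)
Lemma strictly_differentiable V W (O : set V) (f : V -> W) x (eps : R) :
  finite_dimensional V -> finite_dimensional W ->
  open O -> C1_on O f -> O x -> 0 < eps ->
  exists2 r : R, 0 < r & [/\ ball x r `<=` O,
    forall z v, ball x r z -> `|'d f z v - 'd f x v| <= eps * `|v|
    & forall a b, ball x r a -> ball x r b ->
      `|f a - f b - 'd f x (a - b)| <= eps * `|a - b|].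
Proof.
move=> fdV [n [c [d [cc cd cK dK]]]] oO C1f Ox e0.
have [C C0 hC] := linear_lipschitz cc; have [D D0 hD] := linear_lipschitz cd.
have del0 : 0 < Num.min eps (eps / C / D) by rewrite lt_min e0 !divr_gt0.
set del := Num.min _ _ in del0.
have dele : del <= eps by rewrite /del ge_min lexx.
have delCD : D * (C * del) <= eps.
  by rewrite mulrA mulrC -ler_pdivlMr ?mulr_gt0// (mulrC D) invfM mulrA /del ge_min lexx orbT.
have : \forall z \near x, O z /\ forall v, `|'d f z v - 'd f x v| <= del * `|v|.
  near=> z; split; first by near: z; exact: open_nbhs_nbhs.
  by near: z; exact: C1_on_operator Ox del0.
move=> /nbhs_ballP[r /= r0 hr]; exists r => //; split.
- by move=> z /hr[].
- move=> z v /hr[_ h]; by rewrite (le_trans (h v))// ler_wpM2r.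
move=> a b xa xb; set u := f a - _ - _; rewrite -(cK u) (le_trans (hD _))//.
suff cu : `|c u| <= C * del * `|a - b|.
  by rewrite (@le_trans _ _ (D * (C * del * `|a - b|))) ?ler_pM2l// mulrA ler_wpM2r.
apply: rV_norm_le => [|i]; first by rewrite !mulr_ge0 ?(ltW del0) ?(ltW C0).
have cl : linear (fun v : 'rV[R]_n => v 0 i) by move=> k y z; rewrite /= !mxE.
apply: (mean_value (g := linear_pack cl \o c)).
  by move=> v; apply: continuous_comp; [exact: cc|exact: rV_linear_continuous].
move=> t t01 z; have xz : ball x r z.
  have -> : z = t *: a + (1 - t) *: b.
    by rewrite /z scalerBr scalerBl scale1r addrC addrA addrAC -addrA.
  move: xa xb; rewrite -!ball_normE /ball_/= => xa xb.
  have -> : x - (t *: a + (1 - t) *: b) = t *: (x - a) + (1 - t) *: (x - b).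
    by rewrite !scalerBr addrACA -scalerDl [t + _]addrC subrK scale1r -opprD.
  case/andP: t01 => t0 t1; apply: (le_lt_trans (ler_normD _ _)).
  rewrite !normrZ ger0_norm// ger0_norm ?subr_ge0//.
  have [-> |tn0] := eqVneq t 0; first by rewrite mul0r add0r subr0 mul1r.
  have tp : 0 < t by rewrite lt0r tn0.
  have -> : r = t * r + (1 - t) * r by ring.
  by apply: ltr_leD; [rewrite ltr_pM2l|rewrite ler_wpM2l ?subr_ge0// ltW].
have [Oz dz] := hr _ xz; split; first exact: C1_on_diff Oz.
rewrite /= (le_trans (ler_coord _ _))// (le_trans (hC _))// -mulrA ler_pM2l//.
Unshelve. all: by end_near. Qed.

End MeanValue.

(** * The inverse function theorem *)

Section InverseFunction.
Context {R : realType}.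

Lemma half_contraction_fixpoint (E : completeNormedModType R) (f : E -> E) (a : E) (r : R) :
  0 < r ->
  (forall x y, `|x - a| <= r -> `|y - a| <= r -> `|f x - f y| <= 2^-1 * `|x - y|) ->
  (forall x, `|x - a| <= r -> `|f x - a| <= r) ->
  exists2 x, `|x - a| <= r & f x = x.
Proof.
move=> r0 cf sf; pose U := [set x | `|x - a| <= r].
have fU : {homo f : x / U x >-> U x} by move=> x; exact: sf.
pose F := mkfun_fun fU.
have cF : is_contraction F.
  exists (2^-1)%:nng; split; first by rewrite /= invf_lt1 ?ltr1n.
  by move=> [x y] [Ux Uy] /=; exact: cf.
have clU : closed U.
  rewrite (_ : U = (fun x : E => `|x - a|) @^-1` [set t | t <= r])//.
  apply: closed_comp; last exact: closed_le.
  move=> x _; apply: cvg_norm; apply: cvgB; [exact: cvg_id|exact: cvg_cst].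
have [|x Ux fx] := banach_fixed_point cF clU; last by exists x.
by exists a; rewrite /U/= subrr normr0 ltW.
Qed.

(** A Cauchy filter stays Cauchy in a chart, and its limit there comes back by
    continuity of the inverse chart. *)
Lemma fd_complete (E : normedModType R) (F : set_system E) :
  finite_dimensional E -> ProperFilter F -> cauchy F -> cvg F.
Proof.
move=> [n [c [d [cc cd cK dK]]]] FF /cauchy_ballP cF.
have [C C0 hC] := linear_lipschitz cc.
have /cauchy_cvg : cauchy (c @ F).
  apply/cauchy_ballP => e e0; have eC : 0 < e / C by rewrite divr_gt0.
  have := cF _ eC; rewrite !near_simpl.
  case=> -[A B] /= [FA FB] AB; exists (c @` A, c @` B).
    by split; [apply: filterS FA|apply: filterS FB] => x Ax; exists x.
  move=> [_ _] /= [[x Ax <-] [y By <-]].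
  have := AB (x, y) (conj Ax By); rewrite /= -!ball_normE /ball_/= => xy.
  by rewrite -linearB (le_lt_trans (hC _))// mulrC -ltr_pdivlMr.
move=> /cvg_ex[l cl]; apply/cvg_ex; exists (d l).
have dl : (d \o c) x @[x --> F] --> d l by apply: cvg_comp cl _; exact: cd.
by move=> A /dl /=; apply: (@filterS _ F _) => x /=; rewrite cK.
Qed.

Lemma fd_contraction_fixpoint (E : normedModType R) (f : E -> E) (a : E) (r : R) :
  finite_dimensional E -> 0 < r ->
  (forall x y, `|x - a| <= r -> `|y - a| <= r -> `|f x - f y| <= 2^-1 * `|x - y|) ->
  (forall x, `|x - a| <= r -> `|f x - a| <= r) ->
  exists2 x, `|x - a| <= r & f x = x.
Proof.
move=> fdE.
pose Ec := HB.pack_for (completeNormedModType R) E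
  (Uniform_isComplete.Build E (fun F => @fd_complete E F fdE)).
exact: (@half_contraction_fixpoint Ec).
Qed.

Lemma absorb_half (a b : R) : a <= b + 2^-1 * a -> a <= 2 * b.
Proof. lra. Qed.

(** Picard iteration for Newton's map with the
    derivative frozen at e0 gives the local inverse s; the derivative of s at q
    is the inverse of the derivative of F at s q, because F expands distances
    near e0 at least by a fixed factor. *)
Lemma inverse_function (E : normedModType R) (O : set E) (F : E -> E) e0 :
  finite_dimensional E -> open O -> O e0 -> C1_on O F -> (forall v, 'd F e0 v = 0 -> v = 0) ->
  exists U N (s : E -> E),
  [/\ open U, U e0, U `<=` O, open N & N (F e0)] /\
  [/\ forall q, N q -> U (s q) /\ F (s q) = q,
      forall e, U e -> N (F e) -> s (F e) = e,
      exists k : R, forall q q', N q -> N q' -> `|s q - s q'| <= k * `|q - q'|,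
      C1_on N s &
      forall v, 'd s (F e0) ('d F e0 v) = v].
Proof.
move=> fdE oO Oe0 C1F inj.
have [T [TK KT]] := fd_linear_inverse fdE inj.
have [M M0 hM] := linear_lipschitz (fd_linear_continuous (f := T) fdE).
(* With T the inverse of the derivative at e0 and M a bound for T, this eps
   makes e |-> e - T (F e - q) a contraction of ratio M * eps = 2^-1. *)
pose eps := (2 * M)^-1.
have eps0 : 0 < eps by rewrite invr_gt0 mulr_gt0.
have Meps : M * eps = 2^-1 by rewrite /eps invfM mulrCA mulfV ?mulr1 ?gt_eqF.
have [r r0 [rO rd rs]] := strictly_differentiable fdE fdE oO C1F Oe0 eps0.
have ballE x t (z : E) : ball x t z = (`|z - x| < t) :> Prop.
  by rewrite -ball_normE /ball_/= distrC.
pose U : set E := ball e0 r.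
have expand a b : U a -> U b -> `|a - b| <= 2 * M * `|F a - F b|.
  rewrite -mulrA => Ua Ub; have := rs a b Ua Ub.
  rewrite -{2}(TK (a - b)) => h.
  have h1 := hM ('d F e0 (a - b)).
  have h2 : `|'d F e0 (a - b)| <= `|F a - F b| + eps * `|a - b|.
    rewrite -{1}(subrK (F a - F b) ('d F e0 _)) addrC (le_trans (ler_normD _ _))//.
    rewrite lerD2l distrC; move: h; by rewrite TK.
  have h3 : M * `|'d F e0 (a - b)| <= M * `|F a - F b| + 2^-1 * `|a - b|.
    by rewrite -Meps -mulrA -mulrDr ler_pM2l.
  rewrite TK in h1; have := le_trans h1 h3.
  move: (`|a - b|) (`|F a - F b|) => x y; lra.
have dexpand z v : U z -> `|v| <= 2 * M * `|'d F z v|.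
  rewrite -mulrA => Uz; have := rd z v Uz; have := hM ('d F e0 v); rewrite TK => h1 h2.
  have h3 : `|'d F e0 v| <= `|'d F z v| + eps * `|v|.
    rewrite -{1}(subrK ('d F z v) ('d F e0 _)) addrC (le_trans (ler_normD _ _))//.
    by rewrite lerD2l distrC.
  have h4 : M * `|'d F e0 v| <= M * `|'d F z v| + 2^-1 * `|v|.
    by rewrite -Meps -mulrA -mulrDr ler_pM2l.
  exact/absorb_half/(le_trans h1 h4).
pose r1 := r / 2; have r10 : 0 < r1 by rewrite divr_gt0.
have r1r : r1 < r by rewrite /r1 ltr_pdivrMr// ltr_pMr// ltr1n.
pose N : set E := ball (F e0) (r1 * eps).
have solve q : N q -> exists e, U e /\ F e = q.
  rewrite /N ballE => Nq; pose f e := e - T (F e - q).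
  have clU x : `|x - e0| <= r1 -> U x by move=> h; rewrite /U ballE (le_lt_trans h).
  have cf x y : U x -> U y -> `|f x - f y| <= 2^-1 * `|x - y|.
    move=> Ux Uy; have -> : f x - f y = - T (F x - F y - 'd F e0 (x - y)).
      rewrite [T (_ - _ - _)]linearB TK.
      have -> : F x - F y = (F x - q) - (F y - q) by rewrite opprB addrA subrK.
      by rewrite [T (_ - _ - _)]linearB /f [RHS]opprB (opprD y) addrACA -opprD.
    rewrite normrN (le_trans (hM _))// -Meps -mulrA ler_pM2l//; exact: rs.
  have Ue0 : U e0 by exact: ballxx.
  have [||x xr1 fx] := @fd_contraction_fixpoint E f e0 r1 fdE r10.
  - by move=> x y /clU Ux /clU Uy; exact: cf.
  - move=> x xr; rewrite -(subrK (f e0) (f x)) -addrA (le_trans (ler_normD _ _))//.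
    have h1 := cf x e0 (clU _ xr) Ue0.
    have h2 : `|f e0 - e0| <= M * (r1 * eps).
      rewrite /f addrAC subrr add0r normrN (le_trans (hM _))// ler_pM2l//.
      by rewrite distrC ltW.
    rewrite mulrCA Meps in h2; apply: (le_trans (lerD h1 h2)).
    by rewrite mulrC -mulrDl ler_pdivrMr// mulr_natr mulr2n lerD2r.
  exists x; split; first exact: clU.
  move/eqP: fx; rewrite /f -subr_eq0 addrAC subrr add0r oppr_eq0 => /eqP Tx.
  by apply/eqP; rewrite -subr_eq0 -(KT (F x - q)) Tx linear0.
have [s hs] : exists s : E -> E, forall q, N q -> U (s q) /\ F (s q) = q.
  have /choice[s hs] q : exists e, N q -> U e /\ F e = q.
    have [/solve[e he]|nN] := pselect (N q); first by exists e.
    by exists 0.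
  by exists s.
have slip (q q' : E) : N q -> N q' -> `|s q - s q'| <= 2 * M * `|q - q'|.
  move=> /hs[Us Fs] /hs[Us' Fs']; rewrite -{2}Fs -{2}Fs'; exact: expand.
have sF e : U e -> N (F e) -> s (F e) = e.
  move=> Ue /hs[Us Fs]; apply/eqP; rewrite -subr_eq0 -normr_le0.
  by rewrite (le_trans (expand _ _ Us Ue))// Fs subrr normr0 mulr0.
have [S hS] : exists S : E -> {linear E -> E},
    forall z, U z -> cancel ('d F z) (S z) /\ cancel (S z) ('d F z).
  have /choice[S hS] z : exists g : {linear E -> E}, U z ->
      cancel ('d F z) g /\ cancel g ('d F z).
    have [Uz|nU] := pselect (U z); last by exists \0.
    have [|g hg] := @fd_linear_inverse _ _ ('d F z) fdE; last by exists g.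
    move=> v v0; apply/eqP; rewrite -normr_le0 (le_trans (dexpand _ _ Uz))//.
    by rewrite v0 normr0 mulr0.
  by exists S.
have Sb z v : U z -> `|S z v| <= 2 * M * `|v|.
  by move=> Uz; rewrite (le_trans (dexpand _ (S z v) Uz))// (hS z Uz).2.
have M2 : 0 < 2 * M by rewrite mulr_gt0.
have oN : open N by exact: ball_open.
have nN (q : E) : N q -> nbhs q N by move=> Nq; exact: open_nbhs_nbhs.
have sc (q : E) : N q -> s z @[z --> q] --> s q.
  move=> Nq; apply/cvgrPdist_le => e e_gt0.
  have e1 : 0 < e / (2 * M) by rewrite divr_gt0.
  have qz : \forall z \near q, `|q - z| <= e / (2 * M).
    apply/nbhs_ballP; exists (e / (2 * M)) => //= z.
    by rewrite -ball_normE /ball_/= => /ltW.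
  near=> z.
  rewrite (le_trans (slip _ _ Nq _))//; first by near: z; exact: nN.
  by rewrite mulrC -ler_pdivlMr//; near: z.
have ds (q : E) : N q -> is_diff q s (S (s q)).
  move=> Nq; have [Us Fs] := hs q Nq.
  apply: is_diff_near; first exact: fd_linear_continuous.
  move=> e e_gt0; pose e' := e / (2 * M) / (2 * M).
  have e'0 : 0 < e' by rewrite !divr_gt0.
  have h := sc q Nq _ (differentiableE (C1_on_diff C1F (rO _ Us)) e'0).
  near=> z; have Nz : N z by near: z; exact: nN.
  have [Uz Fz] := hs z Nz.
  have -> : s z - s q - S (s q) (z - q) =
      - S (s q) (F (s z) - F (s q) - 'd F (s q) (s z - s q)).
    by rewrite [S _ (_ - _ - _)]linearB (hS _ Us).1 Fs Fz opprB.
  rewrite normrN (le_trans (Sb _ _ Us))// mulrC -ler_pdivlMr//.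
  apply: (@le_trans _ _ (e' * `|s z - s q|)); first by near: z; exact: h.
  apply: (@le_trans _ _ (e' * (2 * M * `|z - q|))); first by rewrite ler_pM2l// slip.
  by rewrite mulrA /e' divfK ?gt_eqF// mulrAC.
have UFe0 : N (F e0) by apply: ballxx; rewrite mulr_gt0.
have Ue0 : U e0 by exact: ballxx.
exists U, N, s; split; split=> //.
- exact: ball_open.
- by exists (2 * M).
- apply: (C1_onI oN ds) => q Nq v; have [Us Fs] := hs q Nq.
  apply/cvgrPdist_le => e e_gt0.
  have e'0 : 0 < e / (2 * M) by rewrite divr_gt0.
  have h : \forall z \near q, `|'d F (s q) (S (s q) v) - 'd F (s z) (S (s q) v)| <= e / (2 * M).
    have := (C1F _ (rO _ Us)).2 (S (s q) v) => /cvgrPdist_le/(_ _ e'0).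
    exact: (sc q Nq).
  near=> z; have Nz : N z by near: z; exact: nN.
  have [Uz Fz] := hs z Nz.
  have -> : S (s q) v - S (s z) v =
      S (s z) ('d F (s z) (S (s q) v) - 'd F (s q) (S (s q) v)).
    by rewrite linearB (hS _ Uz).1 (hS _ Us).2.
  rewrite (le_trans (Sb _ _ Uz))// mulrC -ler_pdivlMr// distrC; near: z; exact: h.
- move=> v; have /(@diff_val _ _ _ _ _ _ _)-> := ds _ UFe0.
  by rewrite sF// (hS _ Ue0).1.
Unshelve. all: by end_near. Qed.

End InverseFunction.

(** * Regularity of set-valued maps *)

Section Distances.
Context {R : realType}.
Implicit Types V W : normedModType R.

Lemma ball_normrE V (x y : V) (r : R) : ball x r y = (`|x - y| < r) :> Prop.
Proof. by rewrite -ball_normE. Qed.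

Lemma nbhs_normrP V (x : V) (A : set V) :
  nbhs x A <-> exists2 r : R, 0 < r & forall z, `|z - x| < r -> A z.
Proof.
split=> [/nbhs_ballP[r /= r0 h]|[r r0 h]].
  by exists r => // z zx; apply: h; rewrite ball_normrE distrC.
by apply/nbhs_ballP; exists r => //= z; rewrite ball_normrE distrC => /h.
Qed.

Lemma edist_norm V (x y : V) : edist (x, y) = (`|x - y|)%:E.
Proof.
apply/eqP; rewrite eq_le; apply/andP; split.
  apply/lee_addgt0Pr => e e0; rewrite -EFinD; apply: edist_fin.
    by rewrite ltr_wpDl.
  by rewrite ball_normrE /= ltrDl.
rewrite leNgt; apply/negP => /edist_lt_ball /=.
by rewrite ball_normrE ltxx.
Qed.

Lemma edist_inf_le V (A : set V) (x a : V) : A a -> (edist_inf A x <= (`|x - a|)%:E)%E.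
Proof. by move=> Aa; apply: ereal_inf_lbound; exists a => //; exact: edist_norm. Qed.

Lemma edist_inf_lt V (A : set V) (x : V) (t : R) :
  (edist_inf A x < t%:E)%E -> exists2 a, A a & `|x - a| < t.
Proof. by case/ereal_inf_lt => _ [a Aa <-]; rewrite edist_norm lte_fin => h; exists a. Qed.

Lemma le_edist_inf V (A : set V) (x : V) (t k : R) : 0 < k ->
  (forall a, A a -> t <= k * `|x - a|) -> (t%:E <= k%:E * edist_inf A x)%E.
Proof.
move=> k0 h; rewrite -lee_pdivrMl//; apply: le_ereal_inf_tmp => _ [a Aa <-].
by rewrite edist_norm -EFinM lee_fin mulrC ler_pdivrMr// mulrC h.
Qed.

Lemma lipschitz_inP V W (s : V -> W) (A : set V) :
  [lipschitz s q | q in A] <->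
  exists2 k : R, 0 < k & forall q q', A q -> A q' -> `|s q - s q'| <= k * `|q - q'|.
Proof.
split=> [[M [_ h]]|[k k0 h]].
  have M1 : M < `|M| + 1 by rewrite (le_lt_trans (ler_norm M))// ltrDl.
  exists (`|M| + 1); first by rewrite ltr_wpDl.
  by move=> q q' Aq Aq'; exact: (h _ M1 (q, q')).
exists k; split; first exact: num_real.
move=> M kM [q q'] [/= Aq Aq']; apply: (le_trans (h q q' Aq Aq')).
by rewrite ler_wpM2r// ltW.
Qed.

End Distances.

Section LipschitzLocalization.
Context {R : realType}.
Variables (P Q : normedModType R) (F : P -> set Q) (p0 : P) (q0 : Q).
Hypothesis F00 : F p0 q0.

Lemma strong_regularity_ball : strongly_metrically_regular F p0 q0 ->
  exists r k (s : Q -> P), [/\ 0 < r, 0 < k & s q0 = p0] /\ [/\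
    forall q, `|q - q0| < r -> F (s q) q,
    forall p q, `|p - p0| < r -> `|q - q0| < r -> F p q -> p = s q
    & forall q q', `|q - q0| < r -> `|q' - q0| < r -> `|s q - s q'| <= k * `|q - q'|].
Proof.
move=> [s [U [V [pU qV SU /lipschitz_inP[k k0 lip]]]]].
have [r1 r10 rU] := (nbhs_normrP _ _).1 pU; have [r2 r20 rV] := (nbhs_normrP _ _).1 qV.
have SUP p q : V q -> (F p q /\ U p) <-> p = s q.
  by move=> Vq; rewrite -[F p q /\ U p]/((set_inverse F q `&` U) p) SU.
exists (Num.min r1 r2), k, s; split; split=> //.
- by rewrite lt_min r10.
- by symmetry; apply/SUP; [exact: nbhs_singleton qV|split=> //; exact: nbhs_singleton pU].
- by move=> q; rewrite lt_min => /andP[_ /rV Vq]; have [] := (SUP (s q) q Vq).2 erefl.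
- move=> p q; rewrite !lt_min => /andP[/rU Up _] /andP[_ /rV Vq] Fpq.
  exact/SUP.
- by move=> q q'; rewrite !lt_min => /andP[_ /rV Vq] /andP[_ /rV Vq']; exact: lip.
Qed.

(** The Lipschitz bound compares s q with the values of F p near q0; a value far
    from q0 is at a distance from q that dominates the size of the localization. *)
Lemma strong_regularity_regularity :
  strongly_metrically_regular F p0 q0 -> metrically_regular F p0 q0.
Proof.
move=> /strong_regularity_ball[r [k [s [[r0 k0 sq0] [Fs sF lip]]]]].
have r20 : 0 < r / 2 by rewrite divr_gt0.
have r2r : r / 2 < r by rewrite ltr_pdivrMr// ltr_pMr// ltr1n.
have k10 : 0 < k + 1 by rewrite addr_gt0.
exists (k + 1), [set p | `|p - p0| < r / 2], [set q | `|q - q0| < r / 2]; split => //.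
- by apply/nbhs_normrP; exists (r / 2).
- by apply/nbhs_normrP; exists (r / 2).
move=> p q /= pp0 qq0; have qr : `|q - q0| < r by exact: lt_trans r2r.
apply: (le_trans (edist_inf_le p (Fs q qr))).
apply: le_edist_inf => // q' Fpq'.
have [q'r|rq'] := ltP (`|q' - q0|) r.
  rewrite (sF p q')//; last exact: lt_trans r2r.
  by rewrite (le_trans (lip _ _ _ _))// distrC ler_wpM2r// lerDl.
have q0r : `|q0 - q0| < r by rewrite subrr normr0.
have h1 : `|p - s q| <= (k + 1) * (r / 2).
  rewrite -(subrK p0 p) -addrA (le_trans (ler_normD _ _))//.
  rewrite [leRHS]mulrDl mul1r [leRHS]addrC; apply: lerD; first exact: ltW.
  rewrite -sq0 (le_trans (lip _ _ _ _))//.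
  by rewrite ler_pM2l// distrC ltW.
rewrite (le_trans h1)// ler_pM2l//.
have := ler_distD q q' q0; rewrite (distrC q' q) => h.
have := le_trans rq' h; lra.
Qed.

Lemma strong_regularity_subregularity :
  strongly_metrically_regular F p0 q0 -> strongly_metrically_subregular F p0 q0.
Proof.
move=> /strong_regularity_ball[r [k [s [[r0 k0 sq0] [Fs sF lip]]]]].
have k10 : 0 < k + 1 by rewrite addr_gt0.
exists (k + 1), [set p | `|p - p0| < r]; split; first exact: ltW.
  by apply/nbhs_normrP; exists r.
move=> p /= pr; apply: le_edist_inf => // q Fpq.
have q0r : `|q0 - q0| < r by rewrite subrr normr0.
have [qr|rq] := ltP (`|q - q0|) r.
  rewrite (sF p q)// -sq0 (le_trans (lip _ _ _ _))// distrC.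
  by rewrite ler_wpM2r// lerDl.
rewrite (le_trans (ltW pr))// distrC (le_trans rq)// ler_peMl//.
by rewrite lerDr ltW.
Qed.

End LipschitzLocalization.

(** When the graph of F is locally the image of a C1 map e |-> (alpha e, beta e)
    with Lipschitz inverse gamma, solving q in F p amounts to solving the smooth
    square system beta e = q, and regularity is read on its derivative at e0. *)
Section SmoothGraph.
Context {R : realType}.
Variables (E : normedModType R) (F : E -> set E) (O : set E).
Variables (alpha beta : E -> E) (gamma : E -> E -> E) (e0 : E) (k : R).
Hypotheses (fdE : finite_dimensional E) (oO : open O) (Oe0 : O e0).
Hypotheses (C1alpha : C1_on O alpha) (C1beta : C1_on O beta).
Hypothesis graphP : forall p q, O (gamma p q) ->
  F p q <-> p = alpha (gamma p q) /\ q = beta (gamma p q).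
Hypothesis gammaK : forall e, O e -> gamma (alpha e) (beta e) = e.
Hypothesis gamma_lip : \forall p \near alpha e0 & q \near beta e0,
  `|gamma p q - e0| <= k * (`|p - alpha e0| + `|q - beta e0|).

Let p0 := alpha e0.
Let q0 := beta e0.

Lemma smooth_graph_mem e : O e -> F (alpha e) (beta e).
Proof. by move=> Oe; apply/graphP; rewrite gammaK. Qed.

Lemma smooth_graph_lip : exists r K : R, [/\ 0 < r, 0 < K & forall p q,
  `|p - p0| < r -> `|q - q0| < r -> `|gamma p q - e0| <= K * (`|p - p0| + `|q - q0|)].
Proof.
have := gamma_lip; case=> -[A B] /= [pA qB] AB.
have [r1 r10 rA] := (nbhs_normrP _ _).1 pA; have [r2 r20 rB] := (nbhs_normrP _ _).1 qB.
exists (Num.min r1 r2), (`|k| + 1); split; first by rewrite lt_min r10.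
  by rewrite ltr_wpDl.
move=> p q; rewrite !lt_min => /andP[/rA Ap _] /andP[_ /rB Bq].
apply: (le_trans (AB (p, q) (conj Ap Bq))); rewrite /= ler_wpM2r ?addr_ge0//.
by rewrite (le_trans (ler_norm k))// lerDl.
Qed.

(** The localization is alpha o beta^-1.  It is single-valued because gamma sends
    graph points near (p0, q0) into the domain where beta is inverted. *)
Lemma injective_derivative_localization : (forall h, 'd beta e0 h = 0 -> h = 0) ->
  exists s : E -> E, lipschitz_localization (set_inverse F) q0 p0 s /\
    exists2 N, open_nbhs q0 N & C1_on N s.
Proof.
move=> inj.
have [U [N [s [[oU Ue0 UO oN Nq0] [sN sU [m mlip] C1s _]]]]] :=
  inverse_function fdE oO Oe0 C1beta inj.
have sq0 : s q0 = e0 by exact: sU.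
exists (alpha \o s); split; last first.
  have Ns q : N q -> O (s q) by move=> /sN[/UO].
  by exists N; [split|exact: (C1_on_comp fdE oN C1s C1alpha Ns)].
have [r [K [r0 K0 lip]]] := smooth_graph_lip.
have [t t0 tU] : exists2 t : R, 0 < t & forall z, `|z - e0| < t -> U z.
  by apply/nbhs_normrP; exact: open_nbhs_nbhs.
pose d := Num.min r (t / (2 * K)).
have d0 : 0 < d by rewrite lt_min r0 divr_gt0// mulr_gt0.
have gU p q : `|p - p0| < d -> `|q - q0| < d -> U (gamma p q).
  rewrite !lt_min => /andP[pr pt] /andP[qr qt]; apply: tU.
  apply: (le_lt_trans (lip p q pr qr)).
  have -> : t = K * (t / (2 * K) + t / (2 * K)) by field; rewrite gt_eqF.
  by rewrite ltr_pM2l// ltrD.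
have [r1 r10 [r1O _ r1lip]] := strictly_differentiable fdE fdE oO C1alpha Oe0 ltr01.
have [M M0 hM] := fd_linear_bounded ('d alpha e0) fdE.
have cs : s z @[z --> q0] --> e0.
  by rewrite -sq0; apply: differentiable_continuous; exact: C1_on_diff C1s Nq0.
have cas : (alpha \o s) z @[z --> q0] --> p0.
  apply: (cvg_comp s alpha cs); apply: differentiable_continuous.
  exact: C1_on_diff C1alpha Oe0.
pose V := [set q | [/\ N q, `|q - q0| < d, ball e0 r1 (s q) & `|alpha (s q) - p0| < d]].
exists [set p | `|p - p0| < d], V; split.
- by apply/nbhs_normrP; exists d.
- near=> q; split.
  + by near: q; exact: open_nbhs_nbhs.
  + by near: q; apply/nbhs_normrP; exists d.
  + by near: q; apply: cs; exact: nbhsx_ballx.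
  + by rewrite distrC; near: q; have /cvgrPdist_lt/(_ _ d0) := cas.
- move=> q [Nq qd _ asd]; have [Us bs] := sN q Nq.
  rewrite eqEsubset; split=> [p [Fpq pd]|_ ->]; last first.
    split=> //; rewrite /set_inverse/= -{2}bs; apply: smooth_graph_mem; exact: UO.
  have Ug := gU p q pd qd; have [ep eq] := (graphP (UO _ Ug)).1 Fpq.
  rewrite /= {1}ep; congr alpha; rewrite {2}eq sU//.
  by rewrite -eq.
- apply/lipschitz_inP; exists ((M + 1) * (`|m| + 1)).
    by rewrite mulr_gt0// ?addr_gt0// ltr_wpDl.
  move=> q q' [Nq _ bq _] [Nq' _ bq' _] /=.
  apply: (@le_trans _ _ ((M + 1) * `|s q - s q'|)).
    rewrite mulrDl mul1r -(subrK ('d alpha e0 (s q - s q')) (alpha _ - _)) addrC.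
    rewrite (le_trans (ler_normD _ _))// lerD//.
    by rewrite -[leRHS]mul1r r1lip.
  rewrite -mulrA ler_pM2l ?addr_gt0// (le_trans (mlip _ _ Nq Nq'))// ler_wpM2r//.
  by rewrite (le_trans (ler_norm m))// lerDl.
Unshelve. all: by end_near. Qed.

(** Moving e0 along a kernel direction h of the derivative by a step c moves
    beta by o(c), hence by subregularity alpha by o(c) too; but gamma recovers
    the step, of length c |h|, from these two displacements. *)
Lemma subregular_injective_derivative :
  strongly_metrically_subregular F p0 q0 -> forall h, 'd beta e0 h = 0 -> h = 0.
Proof.
move=> [l [U [l0 /nbhs_normrP[u u0 uU] hl]]] h dh.
have [r [K [r0 K0 lip]]] := smooth_graph_lip.
apply/eqP/negPn/negP => hn0; have nh : 0 < `|h| by rewrite normr_gt0.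
have Kl : 0 < K * (l + 1) by rewrite mulr_gt0// ltr_wpDl.
pose eps := (2 * (K * (l + 1)))^-1.
have eps0 : 0 < eps by rewrite invr_gt0 mulr_gt0.
have ca : alpha z @[z --> e0] --> p0.
  apply: differentiable_continuous; exact: C1_on_diff C1alpha Oe0.
have cb : beta z @[z --> e0] --> q0.
  apply: differentiable_continuous; exact: C1_on_diff C1beta Oe0.
have [t t0 ht] : exists2 t : R, 0 < t & forall z, `|z - e0| < t ->
    [/\ O z, `|alpha z - p0| < Num.min r u, `|beta z - q0| < r &
     `|beta z - beta e0 - 'd beta e0 (z - e0)| <= eps * `|z - e0|].
  apply/nbhs_normrP; near=> z; split.
  - by near: z; exact: open_nbhs_nbhs.
  - by rewrite distrC; near: z; move/cvgrPdist_lt: ca; apply; rewrite lt_min r0.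
  - by rewrite distrC; near: z; move/cvgrPdist_lt: cb; apply.
  - near: z; apply: differentiableE => //; exact: C1_on_diff C1beta Oe0.
pose c := t / 2 / `|h|; have c0 : 0 < c by rewrite !divr_gt0.
have ec : `|e0 + c *: h - e0| = c * `|h| by rewrite addrC addKr normrZ gtr0_norm.
have [|Oz az bz dz] := ht (e0 + c *: h).
  by rewrite ec /c divfK ?gt_eqF// ltr_pdivrMr// ltr_pMr// ltr1n.
move: az; rewrite lt_min => /andP[az az'].
set z := e0 + _ in Oz az az' bz dz ec.
have e1 : `|beta z - q0| <= eps * (c * `|h|).
  have zd : z - e0 = c *: h by rewrite addrC addKr.
  by move: dz; rewrite ec zd linearZ/= dh scaler0 subr0.
have e2 : `|alpha z - p0| <= l * (eps * (c * `|h|)).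
  have h1 : (edist_inf (F (alpha z)) q0 <= (`|q0 - beta z|)%:E)%E.
    by apply: edist_inf_le; exact: smooth_graph_mem.
  have := le_trans (hl _ (uU _ az')) (lee_wpmul2l _ h1).
  rewrite -EFinM !lee_fin => /(_ l0) h2.
  by rewrite (le_trans h2)// ler_wpM2l// distrC.
have := lip _ _ az bz; rewrite gammaK// ec; apply/negP; rewrite -ltNge.
apply: (@le_lt_trans _ _ (K * ((l + 1) * (eps * (c * `|h|))))).
  by rewrite ler_pM2l// mulrDl mul1r lerD.
have x0 : 0 < c * `|h| by rewrite mulr_gt0.
have Keps : K * (l + 1) * eps = 2^-1.
  by rewrite /eps invfM mulrCA mulfV ?mulr1 ?gt_eqF.
by rewrite mulrA mulrA Keps gtr_pMl// invf_lt1// ltr1n.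
Unshelve. all: by end_near. Qed.

(** Regularity at p0 solves beta e = q0 + c v with e - e0 of order c, so that v is
    a limit of values of the derivative of beta; a dense range is the whole space,
    and a surjective endomorphism is injective. *)
Lemma regular_injective_derivative :
  metrically_regular F p0 q0 -> forall h, 'd beta e0 h = 0 -> h = 0.
Proof.
move=> [kap [U [V [kap0 /nbhs_singleton Up0 /nbhs_normrP[w w0 wV] hk]]]].
apply: fd_dense_range_injective fdE _ => v eps eps0.
have [->|v0] := eqVneq v 0; first by exists 0; rewrite linear0 subrr normr0 ltW.
have nv : 0 < `|v| by rewrite normr_gt0.
have [r [K [r0 K0 lip]]] := smooth_graph_lip.
pose L := K * (2 * kap + 1).
have L0 : 0 < L by rewrite mulr_gt0// addr_gt0// mulr_gt0.
pose del := eps / (L * `|v|); have del0 : 0 < del by rewrite divr_gt0// mulr_gt0.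
have [t t0 ht] : exists2 t : R, 0 < t & forall z, `|z - e0| < t ->
    O z /\ `|beta z - beta e0 - 'd beta e0 (z - e0)| <= del * `|z - e0|.
  apply/nbhs_normrP; near=> z; split.
  - by near: z; exact: open_nbhs_nbhs.
  - near: z; apply: differentiableE => //; exact: C1_on_diff C1beta Oe0.
pose m := Num.min (Num.min w r) (Num.min (r / (2 * kap)) (t / L)).
have m0 : 0 < m by rewrite !lt_min w0 r0/= !divr_gt0// mulr_gt0.
pose c := m / 2 / `|v|; have c0 : 0 < c by rewrite !divr_gt0.
pose q := q0 + c *: v.
have qq0 : q - q0 = c *: v by rewrite /q addrC addKr.
have nq : `|q - q0| = c * `|v| by rewrite qq0 normrZ gtr0_norm.
have cvm : c * `|v| < m.
  by rewrite /c divfK ?gt_eqF// ltr_pdivrMr// ltr_pMr// ltr1n.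
have cv0 : 0 < c * `|v| by rewrite mulr_gt0.
move: (cvm); rewrite !lt_min => /andP[/andP[cw cr] /andP[cr2 ct]].
have [|p Fpq pp0] := @edist_inf_lt _ _ (set_inverse F q) p0 (2 * kap * (c * `|v|)).
- have Vq : V q by apply: wV; rewrite nq.
  apply: (le_lt_trans (hk _ _ Up0 Vq)).
  apply: (@le_lt_trans _ _ (kap * `|q - q0|)%:E).
    rewrite EFinM lee_wpmul2l ?lee_fin ?(ltW kap0)//.
    by apply: edist_inf_le; exact: smooth_graph_mem.
  by rewrite nq lte_fin -(mulrA 2) (mulr_natl _ 2) mulr2n ltrDl mulr_gt0.
have e1 : `|gamma p q - e0| <= L * (c * `|v|).
  apply: (@le_trans _ _ (K * (`|p - p0| + `|q - q0|))).
    apply: lip; last by rewrite nq.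
    rewrite distrC (lt_trans pp0)// mulrC -ltr_pdivlMr// mulr_gt0//.
  by rewrite /L -mulrA ler_pM2l// mulrDl mul1r nq lerD2r distrC ltW.
have [|Oz dz] := ht (gamma p q).
  by rewrite (le_lt_trans e1)// mulrC -ltr_pdivlMr.
have [_ eq] := (graphP Oz).1 Fpq.
exists (c^-1 *: (gamma p q - e0)).
have -> : v - 'd beta e0 (c^-1 *: (gamma p q - e0)) =
  c^-1 *: (q - q0 - 'd beta e0 (gamma p q - e0)).
  by rewrite linearZ/= scalerBr qq0 scalerA mulVf ?gt_eqF// scale1r.
rewrite normrZ gtr0_norm ?invr_gt0//.
rewrite ler_pdivrMl// {1}eq (le_trans dz)//.
apply: (@le_trans _ _ (del * (L * (c * `|v|)))); first by rewrite ler_pM2l.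
have -> : del * (L * (c * `|v|)) = c * (del * (L * `|v|)) by ring.
by rewrite /del divfK// gt_eqF// mulr_gt0.
Unshelve. all: by end_near. Qed.

End SmoothGraph.

(** * Sublinear functions *)

Section Sublinear.
Context {R : realType}.

Lemma ge0_of_affine (c d : R) : (forall t, 0 < t < 1 -> 0 <= c + d * t) -> 0 <= c.
Proof.
move=> h; rewrite leNgt; apply/negP => c0.
pose D := `|d| + 1; have D0 : 0 < D by rewrite ltr_wpDl.
have cD0 : 0 < - c / (2 * D) by rewrite divr_gt0 ?oppr_gt0 ?mulr_gt0.
pose t := Num.min 2^-1 (- c / (2 * D)).
have t0 : 0 < t by rewrite lt_min invr_gt0 ltr0n.
have t1 : t < 1 by rewrite gt_min invf_lt1 ?ltr1n.
have dt : d * t <= - c / 2.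
  apply: (@le_trans _ _ (D * t)).
    by rewrite ler_wpM2r ?(ltW t0)// (le_trans (ler_norm d))// lerDl.
  apply: (@le_trans _ _ (D * (- c / (2 * D)))).
    by rewrite ler_pM2l// ge_min lexx orbT.
  have -> : D * (- c / (2 * D)) = - c / 2 by field; rewrite gt_eqF.
  by [].
have := h t; rewrite t0 t1 => /(_ isT); lra.
Qed.

Variables (Z : finDimHilbertType R) (theta : Z -> \bar R).
Hypotheses (theta_proper : proper_efun theta) (theta_sub : sublinear theta).
Implicit Types (z p q mu : Z) (a b k t : R).

Local Notation C := (subdifferential theta 0).

Lemma sublinear0 : theta 0 = 0%E.
Proof.
have [t0 th _] := theta_sub; have [/(_ 0) nN _] := theta_proper.
have := th 2 0 (ltr0Sn R 1); move: t0 nN; rewrite scaler0 /edom /=.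
case: (theta 0) => // r _ _ [] h; congr EFin; lra.
Qed.

Lemma epi_add z z' a b : (theta z <= a%:E)%E -> (theta z' <= b%:E)%E ->
  (theta (z + z')%R <= (a + b)%R%:E)%E.
Proof.
have [_ _ sub] := theta_sub; have [nN _] := theta_proper.
move: (nN z) (nN z') (sub z z').
case: (theta z) => // r; case: (theta z') => // s _ _ h; rewrite !lee_fin => ra sb.
by apply: (le_trans h); rewrite lee_fin lerD.
Qed.

Lemma epi_scale z a t : 0 < t -> (theta z <= a%:E)%E -> (theta (t *: z)%R <= (t * a)%R%:E)%E.
Proof.
have [_ th _] := theta_sub; move=> t0 za.
by rewrite th// EFinM lee_wpmul2l// lee_fin ltW.
Qed.

Lemma subdifferential0P mu : C mu <-> forall z, ((inner mu z)%:E <= theta z)%E.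
Proof.
rewrite /subdifferential /= sublinear0; split=> [[_ h] z|h].
  by have := h z; rewrite subr0 add0e.
by split=> // z; rewrite subr0 add0e.
Qed.

Lemma subdifferential_epi mu z a : C mu -> (theta z <= a%:E)%E -> inner mu z <= a.
Proof. by move=> /subdifferential0P h za; rewrite -lee_fin (le_trans (h z)). Qed.

Hypothesis theta_lsc : lower_semicontinuous theta.

(** The point p minimizes theta + (k / 2) |. - z|^2, and the inequality is its
    optimality condition, k (z - p) being a subgradient at p.  A minimizing
    sequence is Cauchy by the parallelogram law, and its limit is a minimizer by
    semicontinuity. *)
Lemma proximal_point mu0 z k : C mu0 -> 0 < k ->
  exists p a, (theta p <= a%:E)%E /\
    forall q b, (theta q <= b%:E)%E -> a + k * inner (z - p) (q - p) <= b.
Proof.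
move=> Cmu0 k0.
pose v p a := a + k / 2 * inner (p - z) (p - z).
pose S : set R := [set r | exists p a, (theta p <= a%:E)%E /\ r = v p a].
have infS : has_inf S.
  split; first by exists (v 0 0), 0, 0; rewrite sublinear0.
  exists (inner mu0 z - (2 * k)^-1 * inner mu0 mu0) => _ [p [a [pa ->]]].
  have h1 := subdifferential_epi Cmu0 pa.
  have := inner_ge0 (k *: (p - z) + mu0); rewrite !innerDl !innerDr !innerZl !innerZr.
  rewrite (innerC mu0 (p - z)).
  have -> : inner mu0 z = inner mu0 p - inner (p - z) mu0.
    by rewrite innerBl (innerC z) (innerC p); ring.
  rewrite /v; move: h1; move: (inner mu0 p) (inner (p - z) mu0) (inner mu0 mu0) (inner (p - z) (p - z)).
  move=> x y w u xa h; rewrite lerBlDr -subr_ge0.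
  have -> : a + k / 2 * u + (2 * k)^-1 * w - (x - y) = (a - x) + (2 * k)^-1 * (k * (k * u) + k * y + (k * y + w)).
    by field; rewrite gt_eqF.
  by rewrite addr_ge0 ?subr_ge0// mulr_ge0// ltW// invr_gt0 mulr_gt0.
pose m := inf S.
have mle p a : (theta p <= a%:E)%E -> m <= v p a.
  by move=> pa; apply: ge_inf; [exact: infS.2|exists p, a].
have /choice[pa hpa] n : exists pa : Z * R, (theta pa.1 <= pa.2%:E)%E /\ v pa.1 pa.2 < m + n.+1%:R^-1.
  have [|_ [p [a [pae ->]]] h] := @inf_adherent R S n.+1%:R^-1 _ infS.
    by rewrite invr_gt0 ltr0n.
  by exists (p, a).
pose p_ n := (pa n).1; pose a_ n := (pa n).2.
have par n l : k / 8 * inner (p_ n - p_ l) (p_ n - p_ l) <= (n.+1%:R^-1 + l.+1%:R^-1) / 2.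
  have [hn1 hn2] := hpa n; have [hl1 hl2] := hpa l.
  have half : 0 < 2^-1 :> R by rewrite invr_gt0 ltr0n.
  have := mle _ _ (epi_scale half (epi_add hn1 hl1)).
  rewrite /v -/(p_ n) -/(p_ l) -/(a_ n) -/(a_ l) in hn2 hl2 *.
  have -> : 2^-1 *: (p_ n + p_ l) - z = 2^-1 *: ((p_ n - z) + (p_ l - z)).
    by rewrite addrACA -opprD scalerBr -mulr2n -[z *+ 2]scaler_nat scalerA mulVf ?scale1r.
  have -> : p_ n - p_ l = (p_ n - z) - (p_ l - z) by rewrite opprB addrA subrK.
  move: hn2 hl2; move: (p_ n - z) (p_ l - z) => x y.
  rewrite innerBl !innerBr !innerZl !innerZr !innerDl !innerDr (innerC y x).
  move: (inner x x) (inner y y) (inner x y).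
  move: (a_ n) (a_ l) (n.+1%:R^-1) (l.+1%:R^-1) => a b en el xx yy xy; clear; lra.
have cp : cvg (p_ n @[n --> \oo]).
  apply: fd_complete; first exact: hilbert_finite_dimensional.
  apply/cauchy_ballP => e e0; rewrite near_simpl.
  have d0 : 0 < k / 8 * e ^+ 2 by rewrite mulr_gt0 ?divr_gt0 ?exprn_gt0.
  have [N _ hN] := near_infty_natSinv_lt (PosNum d0).
  exists ([set n | (N <= n)%N], [set n | (N <= n)%N]); first by split; exists N.
  move=> [n l] /= [/hN hn /hN hl]; rewrite ball_normrE.
  rewrite -(ltr_pXn2r (n := 2)) ?nnegrE ?(ltW e0)// -innerxx.
  rewrite -(ltr_pM2l (x := k / 8)) ?divr_gt0//.
  apply: (le_lt_trans (par n l)).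
  by rewrite ltr_pdivrMr// mulr_natr mulr2n ltrD.
move: cp => /cvg_ex[p cp].
have cn : k / 2 * inner (p_ n - z) (p_ n - z) @[n --> \oo] --> k / 2 * inner (p - z) (p - z).
  under eq_fun do rewrite innerxx expr2.
  rewrite innerxx expr2; apply: cvgM; first exact: cvg_cst.
  by apply: cvgM; apply: cvg_norm; apply: cvgB => //; exact: cvg_cst.
set c := k / 2 * inner (p - z) (p - z) in cn.
have pmc : (theta p <= (m - c)%:E)%E.
  apply/lee_addgt0Pr => e e0; rewrite -EFinD leNgt; apply/negP => /theta_lsc[V Vp hV].
  have e20 : 0 < e / 2 by rewrite divr_gt0.
  have [N _ hN] := near_infty_natSinv_lt (PosNum e20).
  near \oo => n.
  have nN : (N <= n)%N by near: n; exists N.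
  have Vn : V (p_ n) by near: n; exact: (cp _ Vp).
  have cne : `|c - k / 2 * inner (p_ n - z) (p_ n - z)| <= e / 2.
    near: n; move/cvgrPdist_le : cn; exact.
  have [pn vn] := hpa n; have := lt_le_trans (hV _ Vn) pn; rewrite lte_fin.
  have := hN n nN; move: vn cne; rewrite /v /= -/(p_ n) -/(a_ n) ler_distlC.
  move: (k / 2 * _) (a_ n) (n.+1%:R^-1) => x a' en; clear; lra.
exists p, (m - c); split=> // q b qb.
rewrite -subr_ge0; apply: (ge0_of_affine (d := k / 2 * inner (q - p) (q - p))) => t /andP[t0 t1].
have t10 : 0 < 1 - t by rewrite subr_gt0.
have := mle _ _ (epi_add (epi_scale t10 pmc) (epi_scale t0 qb)); rewrite /v.
have -> : (1 - t) *: p + t *: q - z = (p - z) + t *: (q - p).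
  by rewrite scalerBl scale1r scalerBr -(addrA p) (addrAC p) (addrC (- (t *: p))).
have -> : z - p = - (p - z) by rewrite opprB.
rewrite /c; move: (p - z) (q - p) => w d.
rewrite !innerDl !innerDr !innerZl !innerZr innerNl (innerC d w).
move: (inner w w) (inner w d) (inner d d) => ww wd dd h.
rewrite -(pmulr_rge0 _ t0); move: h; clear; lra.
Unshelve. all: by end_near. Qed.

(** A lower semicontinuous sublinear function is linear on the directions that
    do not separate its subgradients.  At the proximal points p of z the
    subgradient mu = k (z - p) is no longer than mu0, so p tends to z as k grows
    while theta p <= <mu0, z>. *)
Lemma sublinear_lineality mu0 z : C mu0 ->
  (forall mu, C mu -> inner (mu - mu0) z = 0) -> theta z = (inner mu0 z)%:E.
Proof.
move=> Cmu0 orth; apply/eqP; rewrite eq_le ((subdifferential0P mu0).1 Cmu0) andbT.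
rewrite leNgt; apply/negP => /theta_lsc[V /nbhs_normrP[r r0 rV] hV].
pose k := (`|mu0| + 1) / r.
have k0 : 0 < k by rewrite divr_gt0// ltr_wpDl.
have [p [a [pa hpa]]] := proximal_point z Cmu0 k0.
pose mu := k *: (z - p).
have {}hpa q b : (theta q <= b%:E)%E -> a + inner mu (q - p) <= b.
  by move=> /hpa; rewrite innerZl.
have Cmu : C mu.
  apply/subdifferential0P => w; have [nN _] := theta_proper.
  move: (nN w); case E : (theta w) => [s| |] // _; last by rewrite leey.
  have ws : (theta w <= s%:E)%E by rewrite E.
  by have := hpa _ _ (epi_add pa ws); rewrite addrAC subrr add0r lerD2l lee_fin.
have amu : a <= inner mu p.
  have := hpa 0 0; rewrite sublinear0 sub0r innerNr => /(_ (lexx _)).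
  by rewrite subr_le0.
have pz : p = z - k^-1 *: mu by rewrite /mu scalerA mulVf ?gt_eqF// scale1r opprB addrC subrK.
have mumu : inner mu p = inner mu0 z - k^-1 * inner mu mu.
  by rewrite {1}pz innerBr innerZr; congr (_ - _); apply/eqP; rewrite -subr_eq0 -innerBl orth.
have nmu : `|mu| <= `|mu0|.
  apply: norm_le_inner => //.
  have h1 : inner mu0 p <= inner mu p.
    by rewrite (le_trans _ amu)// (subdifferential_epi Cmu0 pa).
  have h2 : inner mu0 p = inner mu0 z - k^-1 * inner mu0 mu.
    by rewrite {1}pz innerBr innerZr.
  move: h1; rewrite mumu h2 lerD2l lerN2 ler_pM2l ?invr_gt0// => h.
  by rewrite (le_trans h)// inner_le.
have := hV p; rewrite ltNge (le_trans pa) ?lee_fin; last first.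
  by rewrite (le_trans amu)// mumu gerBl mulr_ge0 ?inner_ge0// invr_ge0 ltW.
have pzr : `|p - z| < r.
  rewrite pz addrAC subrr add0r normrN normrZ gtr0_norm ?invr_gt0//.
  rewrite ltr_pdivrMl// (le_lt_trans nmu)// /k divfK ?gt_eqF//.
  by rewrite ltrDl.
by move=> /(_ (rV _ pzr)).
Qed.

End Sublinear.

(** * Affine hulls *)

Section AffineHull.
Context {R : realType} {V : finDimHilbertType R}.
Implicit Types (A : set V) (x y : V).

Lemma affine_hull_sub A : A `<=` affine_hull A.
Proof.
move=> x Ax; exists 1%N, (fun=> x), (fun=> 1); split=> //.
  by rewrite big_ord1.
by rewrite big_ord1 scale1r.
Qed.

Lemma affine_hull_line A x y (s : R) : affine_hull A x -> affine_hull A y ->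
  affine_hull A (x + s *: (y - x)).
Proof.
move=> [n [c [t [Ac t1 ->]]]] [m [d [u [Ad u1 ->]]]].
pose cd (i : 'I_(n + m)) :=
  match fintype.split i with inl j => c j | inr j => d j end.
pose tu (i : 'I_(n + m)) :=
  match fintype.split i with inl j => (1 - s) * t j | inr j => s * u j end.
have E1 (j : 'I_n) : fintype.split (lshift m j) = inl j.
  by case: fintype.splitP => k /= h; [congr inl; exact: val_inj|have := ltn_ord j; rewrite h ltnNge leq_addr].
have E2 (j : 'I_m) : fintype.split (rshift n j) = inr j.
  by case: fintype.splitP => k /= h; [have := ltn_ord k; rewrite -h ltnNge leq_addr|congr inr; apply: val_inj; move/addnI: h].
exists (n + m)%N, cd, tu; split.
- by move=> i; rewrite /cd; case: (fintype.split i).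
- rewrite big_split_ord/=; under eq_bigr do rewrite /tu E1.
  under [X in _ + X]eq_bigr do rewrite /tu E2.
  by rewrite -!mulr_sumr t1 u1 !mulr1 subrK.
rewrite big_split_ord/=; under [in RHS]eq_bigr do rewrite /tu /cd E1 -scalerA.
under [X in _ = _ + X]eq_bigr do rewrite /tu /cd E2 -scalerA.
rewrite -!scaler_sumr; set X := \sum_(i < n) _; set Y := \sum_(i < m) _.
by rewrite scalerBl scale1r scalerBr -[RHS]addrA (addrC (- _)).
Qed.

(** The point is the midpoint of two points of the hull, taken at the parameters
    2 s and - 2 s on the lines from x to y and from x to z. *)
Lemma affine_hull_shift A x y z (s : R) :
  affine_hull A x -> affine_hull A y -> affine_hull A z ->
  affine_hull A (x + s *: (y - z)).
Proof.
move=> hx hy hz.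
have h1 := affine_hull_line (2 * s) hx hy.
have h2 := affine_hull_line (- (2 * s)) hx hz.
have := affine_hull_line 2^-1 h1 h2; congr (affine_hull A _).
have -> : y - z = (y - x) - (z - x) by rewrite opprB addrA subrK.
move: (y - x) (z - x) => a b; rewrite -addrA; congr (x + _).
rewrite opprD addrACA subrr add0r scalerBr !scalerA mulrN mulKf ?pnatr_eq0//.
by rewrite scaleNr mulr_natl mulr2n scalerDl addrACA subrr addr0 scalerBr.
Qed.

Lemma parallel_subspace_linear A : A !=set0 -> linear_subspace (parallel_subspace A).
Proof.
move=> [x Ax]; have hx := affine_hull_sub Ax; split.
  by exists x => //; exists x => //; rewrite subrr.
move=> s _ _ [a ha [b hb <-]] [a' ha' [b' hb' <-]].
exists (a' + s *: (a - b)); first exact: affine_hull_shift.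
by exists b' => //; rewrite addrAC [LHS]addrC.
Qed.

Lemma parallel_subspace_sub A x y : A x -> A y -> parallel_subspace A (x - y).
Proof. by move=> Ax Ay; exists x; [exact: affine_hull_sub|exists y => //; exact: affine_hull_sub]. Qed.

Lemma affine_hull_image (W : finDimHilbertType R) (f : {linear V -> W}) (A : set V) (B : set W) x :
  (forall v, A v -> B (f v)) -> affine_hull A x -> affine_hull B (f x).
Proof.
move=> AB [n [c [t [Ac t1 ->]]]]; exists n, (f \o c), t; split=> //.
  by move=> i; apply: AB.
by rewrite linear_sum; apply: eq_bigr => i _; rewrite linearZ.
Qed.

End AffineHull.

(** * Gradients and adjoint derivatives *)

Section AdjointCalculus.
Context {R : realType}.
Implicit Types U V W : normedModType R.

Lemma is_diff_linear_comp U V W (f df : U -> V) (g : {linear V -> W}) x :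
  finite_dimensional V -> is_diff x f df -> is_diff x (fun z => g (f z) : W) (fun v => g (df v)).
Proof.
move=> fdV dfx; have cg : continuous g by exact: fd_linear_continuous.
have dg : is_diff (f x) g g.
  by apply: DiffDef; [exact: linear_differentiable|exact: diff_lin].
exact: (@is_diff_comp _ _ _ _ f df g g x dfx dg).
Qed.

Lemma is_diff_sum U (V : normedModType R) n (f df : 'I_n -> U -> V) x :
  (forall i, is_diff x (f i) (df i)) ->
  is_diff x (fun z => \sum_i f i z) (fun v => \sum_i df i v).
Proof.
elim: n f df => [|n IH] f df h.
  have -> : (fun z => \sum_(i < 0) f i z) = cst 0 by apply/funext => v; rewrite big_ord0.
  have -> : (fun v => \sum_(i < 0) df i v) = 0 by apply/funext => v; rewrite big_ord0.
  exact: is_diff_cst.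
have -> : (fun z => \sum_i f i z) = f ord0 + (fun z => \sum_i f (lift ord0 i) z).
  by apply/funext => z; rewrite big_ord_recl.
have -> : (fun z => \sum_i df i z) = df ord0 + (fun z => \sum_i df (lift ord0 i) z).
  by apply/funext => z; rewrite big_ord_recl.
by apply: is_diffD; apply: IH.
Qed.

Lemma is_diff_inner U (V : finDimHilbertType R) (f g df dg : U -> V) x :
  is_diff x f df -> is_diff x g dg ->
  is_diff x (fun z => inner (f z) (g z)) (fun v => inner (df v) (g x) + inner (f x) (dg v)).
Proof.
move=> hf hg.
have [n [e [oe _ be]]] := orthonormal_basis (@setT_subspace _ V).
have fdV := hilbert_finite_dimensional V.
have E a b : inner a b = \sum_i inner (e i) a * inner (e i) b.
  by rewrite -[a in LHS](be _ I) inner_suml; apply: eq_bigr => i _; rewrite innerZl.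
have -> : (fun z => inner (f z) (g z)) = fun z => \sum_i inner (e i) (f z) * inner (e i) (g z).
  by apply/funext => z; exact: E.
have -> : (fun v => inner (df v) (g x) + inner (f x) (dg v)) =
    fun v => \sum_i (inner (e i) (f x) * inner (e i) (dg v)
      + inner (e i) (g x) * inner (e i) (df v)).
  apply/funext => v; rewrite !E big_split/= addrC; congr (_ + _).
  by apply: eq_bigr => i _; rewrite mulrC.
apply: is_diff_sum => i.
have h1 := is_diff_linear_comp (inner (e i)) fdV hf.
have h2 := is_diff_linear_comp (inner (e i)) fdV hg.
exact: (is_diff_eq (is_diffM _ _)).
Qed.

Variables Y Z : finDimHilbertType R.
Implicit Types (O : set Y) (Xi : Y -> Z).

Lemma C1_on_adjoint U (D : set U) O Xi (f : U -> Y) (h : U -> Z) :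
  open D -> C1_on D f -> C1_on D h -> (forall x, D x -> O (f x)) -> C2_on O Xi ->
  C1_on D (fun x => adjoint ('d Xi (f x)) (h x)).
Proof.
move=> oD C1f C1h fO [_ C2].
have [n [b [ob _ bb]]] := orthonormal_basis (@setT_subspace _ Y).
apply: (C1_on_eq (f := fun x => \sum_i inner (h x) ('d Xi (f x) (b i)) *: b i) oD).
  by move=> x _; rewrite (adjoint_expansion _ _ (fun v => bb v I)).
apply: (C1_on_sum oD) => i.
have sl : linear (fun r : R => r *: b i).
  by move=> a y z; rewrite /= scalerDl scalerA.
pose sc : {linear R -> Y} := linear_pack sl.
have fdR := real_finite_dimensional R.
apply: (C1_on_linear_comp sc fdR oD).
apply: (C1_on_inner oD C1h).
have fdY := hilbert_finite_dimensional Y.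
exact: (C1_on_comp (g := fun u => 'd Xi u (b i)) fdY oD C1f (C2 _) fO).
Qed.

(** Where h vanishes, the variation of the adjoint factor is of second order. *)
Lemma is_diff_adjoint U O Xi (f df : U -> Y) (h dh : U -> Z) x :
  is_diff x f df -> is_diff x h dh -> O (f x) -> C2_on O Xi -> h x = 0 ->
  is_diff x (fun x => adjoint ('d Xi (f x)) (h x))
    (fun v => adjoint ('d Xi (f x)) (dh v)).
Proof.
move=> hf hh Of [_ C2] hx0.
have [n [b [ob _ bb]]] := orthonormal_basis (@setT_subspace _ Y).
have fdY := hilbert_finite_dimensional Y.
have -> : (fun x => adjoint ('d Xi (f x)) (h x)) =
    fun x => \sum_i inner (h x) ('d Xi (f x) (b i)) *: b i.
  by apply/funext => z; rewrite (adjoint_expansion _ _ (fun v => bb v I)).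
have -> : (fun v => adjoint ('d Xi (f x)) (dh v)) =
    fun v => \sum_i inner (dh v) ('d Xi (f x) (b i)) *: b i.
  by apply/funext => z; rewrite (adjoint_expansion _ _ (fun v => bb v I)).
apply: is_diff_sum => i.
have sl : linear (fun r : R => r *: b i).
  by move=> a y z; rewrite /= scalerDl scalerA.
pose sc : {linear R -> Y} := linear_pack sl.
have fdR := real_finite_dimensional R.
apply: (is_diff_linear_comp sc fdR).
have d1 : is_diff (f x) (fun u => 'd Xi u (b i)) ('d (fun u => 'd Xi u (b i)) (f x)).
  by apply: DiffDef => //; exact: C1_on_diff (C2 (b i)) Of.
have d2 := @is_diff_comp _ _ _ _ _ _ _ _ _ hf d1.
apply: is_diff_eq (is_diff_inner hh d2) _; apply/funext => v.
by rewrite hx0 inner0l addr0.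
Qed.

Lemma grad_inner O Xi mu u : C1_on O Xi -> O u ->
  grad (fun u => inner mu (Xi u)) u = adjoint ('d Xi u) mu.
Proof.
move=> C1Xi Ou; rewrite /grad /adjoint; congr riesz.
have dXi : is_diff u Xi ('d Xi u) by apply: DiffDef => //; exact: C1_on_diff C1Xi Ou.
have fdZ := hilbert_finite_dimensional Z.
by have [_ ->] := is_diff_linear_comp (inner mu) fdZ dXi.
Qed.

Lemma C1_on_grad_inner O Xi mu : open O -> C2_on O Xi ->
  C1_on O (grad (fun u => inner mu (Xi u))).
Proof.
move=> oO C2Xi.
apply: (C1_on_eq (f := fun u => adjoint ('d Xi u) mu) oO).
  by move=> u Ou; rewrite (grad_inner _ C2Xi.1 Ou).
apply: (C1_on_adjoint (O := O) (f := idfun) (h := fun=> mu)) => //.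
- by apply: C1_on_linear => // x; exact: cvg_id.
- exact: C1_on_cst.
Qed.

End AdjointCalculus.

(** * Subgradients and conjugates *)

Section Monotonicity.
Context {R : realType} {Y : finDimHilbertType R}.
Implicit Types (f : Y -> \bar R) (u v y : Y).

Lemma subdifferential_monotone f u v y z :
  subdifferential f u y -> subdifferential f v z -> 0 <= inner (y - z) (u - v).
Proof.
move=> [fu hu] [fv hv]; have := hu v; have := hv u.
rewrite -(fineK fu) -(fineK fv) -!EFinD !lee_fin.
rewrite !innerBl !innerBr; lra.
Qed.

(** Equality holds in the Fenchel-Young inequality at (u, y), so that u also
    supports the conjugate at y. *)
Lemma subdifferential_conjugate f u y :
  subdifferential f u y -> subdifferential (conjugate f) y u.
Proof.
move=> [fu hu].
have cy : conjugate f y = ((inner y u)%:E - f u)%E.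
  apply/eqP; rewrite eq_le; apply/andP; split; last first.
    by apply: ereal_sup_ubound; exists u.
  apply: ge_ereal_sup => _ [v _ <-]; have := hu v.
  rewrite -(fineK fu); case: (f v) => [s| |] //; last by rewrite addeNy leNye.
  rewrite -?EFinB -?EFinD !lee_fin innerBr; lra.
split; first by rewrite cy -(fineK fu) -EFinB.
move=> z; rewrite cy; apply: (@le_trans _ _ ((inner z u)%:E - f u)%E); last first.
  by apply: ereal_sup_ubound; exists u.
rewrite -(fineK fu) -?EFinB -?EFinD lee_fin innerBr !(innerC u); lra.
Qed.

Lemma convex_efun_segment f u v (a b t : R) : convex_efun f -> 0 < t < 1 ->
  (f u <= a%:E)%E -> (f v <= b%:E)%E ->
  (f (u + t *: (v - u))%R <= (a + t * (b - a))%R%:E)%E.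
Proof.
move=> cf /andP[t0 t1] ua vb.
have := cf (v, b) (u, a) (Itv01 (ltW t0) (ltW t1)).
rewrite !inE => /(_ vb ua); rewrite /epigraph /=.
have -> : u + t *: (v - u) = t *: v + (1 - t) *: u.
  by rewrite scalerBl scale1r scalerBr addrCA.
by have -> : a + t * (b - a) = t *: b + (1 - t) *: a by rewrite /GRing.scale /=; ring.
Qed.

End Monotonicity.

(** * The subdifferential of a decomposable function *)

Lemma coercive_le0 (R : realType) (M x y : R) :
  (M + 1) * x + y = 0 -> - y <= M * x -> x <= 0.
Proof. lra. Qed.

Lemma first_order_bound (R : realType) (t eps b G A1 A2 A3 : R) :
  A1 <= t * eps -> G + A3 <= G + t * (b - G) -> - (A3 - t * A2) <= A1 ->
  0 <= t * (eps + (b - (G + A2))).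
Proof. lra. Qed.

Section Decomposition.
Context {R : realType}.
Variables (Y Z : finDimHilbertType R) (g : Y -> \bar R) (ubar : Y).
Variables (O : set Y) (theta : Z -> \bar R) (Xi : Y -> Z).
Hypotheses (dec : C2_decomposition g ubar O theta Xi).
Hypotheses (nondeg : nondegenerate_at ubar theta Xi).

Local Notation B := ('d Xi ubar).
Local Notation C := (subdifferential theta 0).
Local Notation L := (parallel_subspace C).

Let fdY := hilbert_finite_dimensional Y.
Let fdZ := hilbert_finite_dimensional Z.
Let oO := decomp_open dec.
Let Ou := decomp_mem dec.
Let C2Xi := decomp_C2 dec.
Let Xi0 := decomp_eq0 dec.

Lemma decomp_nondeg nu : L nu -> adjoint B nu = 0 -> nu = 0.
Proof.
move=> Ln Bn; have : [set 0] nu by rewrite -nondeg Xi0.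
by [].
Qed.

Lemma decomp_nonempty : C !=set0.
Proof.
have : [set 0 : Z] 0 by [].
rewrite -nondeg Xi0 => -[[_ [[|n] [c [t [Cc t1 _]]]] _] _].
  by move: t1; rewrite big_ord0 => /eqP; rewrite eq_sym oner_eq0.
by exists (c ord0).
Qed.

Variables (n : nat) (e : 'I_n -> Z).
Hypothesis eL : forall i, L (e i).
Hypothesis be : forall v, L v -> orthogonal_projection e v = v.
Local Notation P := (orthogonal_projection e).

Lemma proj_mem v : L (P v).
Proof. exact: subspace_sum (parallel_subspace_linear decomp_nonempty) eL. Qed.

Lemma projK v : P (P v) = P v.
Proof. exact/be/proj_mem. Qed.

Lemma proj_complement z zeta : P (P z + (zeta - P zeta)) = P z.
Proof. by rewrite linearD linearB/= !projK subrr addr0. Qed.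

Lemma proj_subgradients mu nu : C mu -> C nu -> P (mu - nu) = mu - nu.
Proof. by move=> Cm Cn; apply: be; exact: parallel_subspace_sub. Qed.

Lemma inner_proj_ker nu z : P nu = nu -> P z = 0 -> inner nu z = 0.
Proof. by move=> <- Pz; rewrite inner_projection Pz inner0r. Qed.

Lemma adjoint_proj_inj nu : adjoint B (P nu) = 0 -> P nu = 0.
Proof. by apply: decomp_nondeg; exact: proj_mem. Qed.

(** Let B^* P x be the projection of v on the range of B^* P.  The difference d is
    orthogonal to that range, so P (B d) = 0; by hypothesis it is then orthogonal
    to v, and hence to itself. *)
Lemma normal_of_kernel v : (forall w, P (B w) = 0 -> inner v w = 0) ->
  exists zeta, v = adjoint B (P zeta).
Proof.
move=> h; have [x hx] := range_orthogonal (adjoint B \o P) v; exists x.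
apply/eqP; rewrite -subr_eq0; apply/eqP; apply: inner_eq0.
set d := v - _ in hx *; rewrite /= in hx.
have Pd : P (B d) = 0.
  by apply: inner_inj => z; rewrite inner_projection inner0l innerC -adjointP innerC hx.
by rewrite {2}/d innerBr hx innerC h// subr0.
Qed.

(** A vector of L orthogonal to the range of P B is annihilated by B^*, hence is
    zero by nondegeneracy. *)
Lemma proj_derivative_surjective z : exists w, P (B w) = P z.
Proof.
have [x hx] := range_orthogonal (P \o B) (P z); exists x.
apply/eqP; rewrite eq_sym -subr_eq0; apply/eqP; apply: decomp_nondeg.
  by rewrite -linearB; exact: proj_mem.
apply: inner_inj => w; rewrite adjointP inner0l -(hx w) /=.
by rewrite -linearB [in LHS]inner_projection [in RHS]inner_projection projK.
Qed.

Lemma theta_lineality mu r : C mu -> P r = 0 -> theta r = (inner mu r)%:E.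
Proof.
move=> Cmu Pr.
apply: (sublinear_lineality (decomp_proper dec) (decomp_sublinear dec) (decomp_lsc dec) Cmu).
by move=> nu Cnu; apply: inner_proj_ker => //; exact: proj_subgradients.
Qed.

Lemma theta_shift mu r z a : C mu -> P r = 0 ->
  (theta z <= a%:E)%E -> (theta (z + r)%R <= (a + inner mu r)%R%:E)%E.
Proof.
move=> Cmu Pr za; apply: (epi_add (decomp_proper dec) (decomp_sublinear dec)) => //.
by rewrite (theta_lineality Cmu Pr).
Qed.

(** The equations whose solutions parametrize the subgradients (u, y) near
    ubar: Xi u stays in the kernel of P, where theta is linear, while
    y = Xi'(u)^* (mu + P zeta) and the first row reads q = rho u + y.  The
    summand zeta - P zeta removes the freedom in zeta and keeps the system square.  Taking rho large makes the derivative
    injective whatever the curvature of <mu, Xi>. *)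
Definition chart_map (rho : R) (mu : Z) (p : Y * Z) : Y * Z :=
  (rho *: p.1 + adjoint ('d Xi (p.1)) (mu + P p.2), P (Xi p.1) + (p.2 - P p.2)).

Local Notation H mu := (hess (fun u => inner mu (Xi u)) ubar).

Definition chart_derivative (rho : R) (mu : Z) (h : Y * Z) : Y * Z :=
  (rho *: h.1 + H mu h.1 + adjoint B (P h.2), P (B h.1) + (h.2 - P h.2)).

Lemma chart_derivative_injective mu : exists2 rho : R, 0 < rho &
  forall h, chart_derivative rho mu h = 0 -> h = 0.
Proof.
have [M M0 hM] := fd_linear_bounded ('d (grad (fun u => inner mu (Xi u))) ubar) fdY.
exists (M + 1) => [|[du dz] [e1 e2]]; first by rewrite addr_gt0.
have Pdu : P (B du) = 0.
  by have := congr1 P e2; rewrite proj_complement linear0.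
have dzP : P dz = dz.
  by move: e2; rewrite /= Pdu add0r => /eqP; rewrite subr_eq0 => /eqP.
have du0 : du = 0.
  apply/eqP; rewrite -normr_le0; have := congr1 (inner^~ du) e1.
  rewrite /= inner0l !innerDl innerZl adjointP (inner_proj_ker (projK dz) Pdu) addr0.
  rewrite innerxx => e3.
  have h1 : - inner (H mu du) du <= M * `|du| ^+ 2.
    rewrite -innerNl (le_trans (inner_le _ _))// normrN expr2 mulrA.
    by rewrite ler_wpM2r//; exact: hM.
  have h2 := coercive_le0 e3 h1.
  by rewrite -(@ler_pXn2r _ 2) ?nnegrE// expr0n.
move: e1; rewrite /= du0 scaler0 /hess linear0 !add0r => /adjoint_proj_inj.
by rewrite dzP => ->.
Qed.

Lemma C1_on_chart_map rho mu : C1_on (O `*` [set: Z]) (chart_map rho mu).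
Proof.
have oD : open (O `*` [set: Z]) by apply: open_setX => //; exact: openT.
have c1 : continuous (fst : Y * Z -> Y) by move=> x; exact: cvg_fst.
have c2 : continuous (snd : Y * Z -> Z) by move=> x; exact: cvg_snd.
have C1f : C1_on (O `*` [set: Z]) (fst : Y * Z -> Y) by exact: C1_on_linear.
have C1s : C1_on (O `*` [set: Z]) (snd : Y * Z -> Z) by exact: C1_on_linear.
have C1P : C1_on (O `*` [set: Z]) (fun p : Y * Z => P p.2).
  exact: (C1_on_linear_comp P fdZ oD C1s).
apply: (C1_on_pair oD); apply: (C1_on_add oD).
- exact: (C1_on_linear_comp (GRing.scale rho) fdY oD C1f).
- apply: (C1_on_adjoint (O := O) oD C1f _ _ C2Xi); last by move=> x [].
  exact: (C1_on_add oD (C1_on_cst mu oD) C1P).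
- apply: (C1_on_linear_comp P fdZ oD).
  by apply: (C1_on_comp fdY oD C1f C2Xi.1) => x [].
- by apply: (C1_on_add oD C1s); exact: (C1_on_linear_comp (@GRing.opp Z) fdZ oD).
Qed.

Lemma is_diff_chart_map rho mu :
  is_diff ((ubar, 0) : Y * Z) (chart_map rho mu) (chart_derivative rho mu).
Proof.
pose x0 : Y * Z := (ubar, 0).
have c1 : continuous (fst : Y * Z -> Y) by move=> x; exact: cvg_fst.
have c2 : continuous (snd : Y * Z -> Z) by move=> x; exact: cvg_snd.
have d1 : is_diff x0 (fst : Y * Z -> Y) fst.
  by apply: DiffDef; [exact: linear_differentiable|exact: diff_lin].
have d2 : is_diff x0 (snd : Y * Z -> Z) snd.
  by apply: DiffDef; [exact: linear_differentiable|exact: diff_lin].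
pose G := grad (fun u => inner mu (Xi u)).
have dG : is_diff (x0.1) G (H mu).
  by apply: DiffDef => //; exact: C1_on_diff (C1_on_grad_inner mu oO C2Xi) Ou.
have dXi : is_diff (x0.1) Xi B by apply: DiffDef => //; exact: C1_on_diff C2Xi.1 Ou.
have dP := is_diff_linear_comp P fdZ d2.
have dPXi := is_diff_linear_comp P fdZ (@is_diff_comp _ _ _ _ _ _ _ _ _ d1 dXi).
have dA : is_diff x0 (fun p : Y * Z => adjoint ('d Xi (p.1)) (P p.2))
    (fun v => adjoint B (P v.2)).
  by apply: (is_diff_adjoint d1 dP Ou C2Xi); rewrite /= linear0.
have dG1 := @is_diff_comp _ _ _ _ _ _ _ _ _ d1 dG.
have dr := is_diff_linear_comp (GRing.scale rho) fdY d1.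
have dF1 := @is_diffD _ _ _ _ _ _ _ _ (@is_diffD _ _ _ _ _ _ _ _ dr dG1) dA.
have dF2 := @is_diffD _ _ _ _ _ _ _ _ dPXi (@is_diffB _ _ _ _ _ _ _ _ d2 dP).
have := @is_diff_pair _ _ _ _ _ _ _ _ _ dF1 dF2.
apply: is_diff_near_eq; near=> p.
have Op : O p.1 by near: p; apply: cvg_fst; exact: open_nbhs_nbhs.
have Gp : G p.1 = adjoint ('d Xi (p.1)) mu by exact: grad_inner C2Xi.1 Op.
rewrite -[LHS]/(rho *: p.1 + G p.1 + adjoint ('d Xi (p.1)) (P p.2),
                P (Xi p.1) + (p.2 - P p.2)).
by rewrite Gp -addrA -linearD.
Unshelve. all: by end_near. Qed.

(** The inverse function theorem for chart_map at (ubar, 0). *)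
Lemma chart mu : exists rho N (s : Y * Z -> Y * Z),
  [/\ 0 < rho, open N, N (rho *: ubar + adjoint B mu, 0), C1_on N s &
    s (rho *: ubar + adjoint B mu, 0) = (ubar, 0)] /\
  [/\ forall q, N q -> O (s q).1,
    forall q, N q -> rho *: (s q).1 + adjoint ('d Xi ((s q).1)) (mu + P (s q).2) = q.1,
    forall q, N q -> P (Xi (s q).1) + ((s q).2 - P (s q).2) = q.2,
    forall h, 'd s (rho *: ubar + adjoint B mu, 0) (chart_derivative rho mu h) = h &
    forall v, chart_derivative rho mu ('d s (rho *: ubar + adjoint B mu, 0) v) = v].
Proof.
have [rho rho0 inj] := chart_derivative_injective mu.
have dF := is_diff_chart_map rho mu.
have F0 : chart_map rho mu (ubar, 0) = (rho *: ubar + adjoint B mu, 0).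
  by rewrite /chart_map /= Xi0 !linear0 !addr0.
have oD : open (O `*` [set: Z]) by apply: open_setX => //; exact: openT.
have fdE := prod_finite_dimensional fdY fdZ.
have dFE h : 'd (chart_map rho mu) (ubar, 0) h = chart_derivative rho mu h.
  by case: dF => _ ->.
have inj' h : 'd (chart_map rho mu) (ubar, 0) h = 0 -> h = 0.
  by rewrite dFE; exact: inj.
have D0 : (O `*` [set: Z]) (ubar, 0) by split.
have [U [N [s [[oU Ue0 UO oN Nq0] [sN sU [k slip] C1s ds]]]]] :=
  inverse_function fdE oD D0 (@C1_on_chart_map rho mu) inj'.
rewrite F0 in Nq0 ds *.
have s0 : s (rho *: ubar + adjoint B mu, 0) = (ubar, 0) by rewrite -F0 sU// F0.
exists rho, N, s; split; split; [exact: rho0|exact: oN|exact: Nq0|exact: C1s|exact: s0|..].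
- by move=> q /sN[/UO[]].
- by move=> q /sN[_ Fq]; rewrite -[in RHS]Fq.
- by move=> q /sN[_ Fq]; rewrite -[in RHS]Fq.
- by move=> h; rewrite -dFE; exact: ds.
have [T [_ KT]] := fd_linear_inverse fdE inj'.
move=> v; have dsT : 'd s (rho *: ubar + adjoint B mu, 0) v = T v.
  by rewrite -{1}(KT v); exact: ds.
by rewrite dsT -dFE; exact: KT.
Qed.

(** Points leaving ubar in the direction w along which Xi moves, to first
    order, as its linearization does, with no error at all in the component in L;
    an error in the kernel of P is harmless because theta is linear there.  They
    come from the inverse chart, moving from its base point along the image of
    (w, 0) under the derivative of the chart. *)
Lemma tangent_points w (eps del : R) : 0 < eps -> 0 < del ->
  exists t u, [/\ 0 < t < del, O u, `|u - ubar - t *: w| <= eps * t,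
    P (Xi u - t *: B w) = 0 & `|Xi u - t *: B w| <= eps * t].
Proof.
move=> eps0 del0.
have [rho [N [s [[rho0 oN Nq0 C1s s0] [sO _ s2 ds _]]]]] := chart 0.
set q0 := (_, 0) in Nq0 s0 ds.
pose h := chart_derivative rho 0 (w, 0).
have [M M0 hM] := fd_linear_bounded B fdY.
pose e1 := Num.min eps (eps / 2 / M).
have e10 : 0 < e1 by rewrite lt_min eps0 !divr_gt0.
have we0 : 0 < `|w| + eps by rewrite ltr_wpDl.
pose e2 := eps / 2 / (`|w| + eps); have e20 : 0 < e2 by rewrite !divr_gt0.
have h10 : 0 < `|h| + 1 by rewrite ltr_wpDl.
have e30 : 0 < e1 / (`|h| + 1) by rewrite divr_gt0.
have [r1 r10 hr1] : exists2 r : R, 0 < r & forall q, `|q - q0| < r ->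
    N q /\ `|s q - s q0 - 'd s q0 (q - q0)| <= e1 / (`|h| + 1) * `|q - q0|.
  apply/nbhs_normrP; near=> q; split; first by near: q; exact: open_nbhs_nbhs.
  by near: q; exact: (differentiableE (C1_on_diff C1s Nq0) e30).
have [r2 r20 hr2] : exists2 r : R, 0 < r & forall u, `|u - ubar| < r ->
    `|Xi u - Xi ubar - B (u - ubar)| <= e2 * `|u - ubar|.
  by apply/nbhs_normrP; exact: (differentiableE (C1_on_diff C2Xi.1 Ou) e20).
pose m := Num.min del (Num.min (r1 / (`|h| + 1)) (r2 / (`|w| + eps))).
have m0 : 0 < m by rewrite !lt_min del0 !divr_gt0.
pose t := m / 2; have t0 : 0 < t by rewrite divr_gt0.
have : t < m by rewrite /t ltr_pdivrMr// ltr_pMr// ltr1n.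
rewrite !lt_min => /and3P[td]; rewrite !ltr_pdivlMr// => th tw.
pose q := q0 + t *: h; pose u := (s q).1.
have qq0 : q - q0 = t *: h by rewrite /q addrC addKr.
have nq : `|q - q0| = t * `|h| by rewrite qq0 normrZ gtr0_norm.
have [|Nq dq] := hr1 q.
  by rewrite nq (le_lt_trans _ th)// ler_pM2l// lerDl.
have u1 : `|u - ubar - t *: w| <= e1 * t.
  apply: (@le_trans _ _ (`|s q - s q0 - 'd s q0 (q - q0)|)).
    have -> : u - ubar - t *: w = (s q - s q0 - 'd s q0 (q - q0)).1.
      have dsh : 'd s q0 h = (w, 0) by exact: ds.
      have dsq : 'd s q0 (q - q0) = t *: ((w, 0) : Y * Z).
        by rewrite -dsh qq0; exact: linearZ.
      by rewrite dsq s0.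
    exact: fst_norm_le.
  rewrite (le_trans dq)// nq mulrAC -mulrA ler_pM2l//.
  by rewrite ler_pdivrMr// ler_pM2l// lerDl.
have ue : `|u - ubar| <= t * (`|w| + eps).
  rewrite -(subrK (t *: w) (u - ubar)) (le_trans (ler_normD _ _))//.
  rewrite mulrDr addrC normrZ gtr0_norm// lerD2l mulrC (le_trans u1)//.
  by rewrite ler_pM2r// ge_min lexx.
exists t, u; split; first by rewrite t0.
- exact: sO.
- by rewrite (le_trans u1)// ler_pM2r// ge_min lexx.
- have q2 : q.2 = t *: P (B w).
    rewrite -[q.2]/(0 + t *: (P (B w) + (0 - P 0))).
    by rewrite [P 0]linear0 subr0 addr0 add0r.
  have := congr1 P (s2 q Nq); rewrite q2 proj_complement [P (t *: _)]linearZ/= projK => Pu.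
  by rewrite [P (_ - _)]linearB/= -/u Pu [P (t *: _)]linearZ/= subrr.
have := hr2 u; rewrite Xi0 subr0 => /(_ (le_lt_trans ue tw)) Xu.
have -> : Xi u - t *: B w = (Xi u - B (u - ubar)) + B (u - ubar - t *: w).
  have -> : B (u - ubar - t *: w) = B (u - ubar) - t *: B w.
    by rewrite [B (_ - t *: w)]linearB [B (t *: w)]linearZ.
  by rewrite addrA subrK.
rewrite (le_trans (ler_normD _ _))// [eps]splitr mulrDl lerD//.
  rewrite (le_trans Xu)// (@le_trans _ _ (e2 * (t * (`|w| + eps))))//.
    by rewrite ler_pM2l.
  by rewrite mulrCA /e2 divfK ?gt_eqF// mulrC.
rewrite (le_trans (hM _))// (@le_trans _ _ (M * (e1 * t)))//; first by rewrite ler_pM2l.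
by rewrite mulrA ler_pM2r// mulrC -ler_pdivlMr// ge_min lexx orbT.
Unshelve. all: by end_near. Qed.

Lemma decomp_eq_fin u a : O u -> (theta (Xi u) <= a%:E)%E ->
  (g u <= (fine (g ubar) + a)%R%:E)%E.
Proof.
move=> Ou' ta; rewrite (decomp_eq dec Ou') -(fineK (decomp_fin_num dec)) EFinD.
by rewrite /= leeD2l.
Qed.

(** The subgradient inequality at the points u of tangent_points bounds
    t <y, w> by theta (t B w) plus the value of the linear part of theta at the
    error term, which is of order eps t. *)
Lemma subgradient_bound y w a : subdifferential g ubar y ->
  (theta (B w) <= a%:E)%E -> inner y w <= a.
Proof.
move=> [gf hy] ta; have [mu0 Cmu0] := decomp_nonempty.
apply/ler_addgt0Pl => eps eps0.
pose k := `|y| + `|mu0| + 1.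
have k0 : 0 < k by rewrite ltr_wpDl// addr_ge0.
have [t [u [/andP[t0 _] Ou' ut Pr r]]] := tangent_points w (divr_gt0 eps0 k0) ltr01.
have tta : (theta (t *: B w) <= (t * a)%R%:E)%E.
  exact: epi_scale (decomp_sublinear dec) _ _ _ t0 ta.
have := theta_shift Cmu0 Pr tta; rewrite addrC subrK => /(decomp_eq_fin Ou') gu.
have := le_trans (hy u) gu; rewrite -(fineK gf) -EFinD lee_fin lerD2l => h.
rewrite -(ler_pM2l t0).
have h1 : inner y (u - ubar - t *: w) >= - (`|y| * (eps / k * t)).
  by rewrite lerNl -innerNr (le_trans (inner_le _ _))// ler_wpM2l// normrN.
have h2 : inner mu0 (Xi u - t *: B w) <= `|mu0| * (eps / k * t).
  by rewrite (le_trans (inner_le _ _))// ler_wpM2l.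
have h3 : t * inner y w = inner y (u - ubar) - inner y (u - ubar - t *: w).
  by rewrite -innerBr opprB addrC subrK innerZr.
rewrite h3 mulrDr.
have h4 : (`|y| + `|mu0|) * (eps / k * t) <= t * eps.
  rewrite mulrA [t * eps]mulrC ler_pM2r// mulrA ler_pdivrMr// mulrC ler_pM2l//.
  by rewrite lerDl.
move: h h1 h2 h4; rewrite mulrDl.
move: (inner y (u - ubar)) (inner y (_ - _)) (inner mu0 _) => A1 A2 A3; lra.
Qed.

(** On the kernel of P B, a subspace where theta (B w) = <mu0, B w>, the bound of
    subgradient_bound applies to w and - w; so y - B^* mu0 is orthogonal to the
    kernel and y = B^* mu with mu = mu0 + P zeta.  That mu lies in C is seen at an
    arbitrary z by moving it, along the kernel of P, into the range of B. *)
Lemma subgradient_lift y : subdifferential g ubar y -> exists2 mu, C mu & adjoint B mu = y.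
Proof.
move=> gy; have [mu0 Cmu0] := decomp_nonempty.
have [|zeta yz] := @normal_of_kernel (y - adjoint B mu0).
  move=> w Pw; rewrite innerBl adjointP.
  have h1 : inner y w <= inner mu0 (B w).
    by apply: (subgradient_bound gy); rewrite (theta_lineality Cmu0 Pw).
  have h2 : inner y (- w) <= inner mu0 (B (- w)).
    apply: (subgradient_bound gy); rewrite (theta_lineality Cmu0) // linearN/=.
    by rewrite linearN/= Pw oppr0.
  move: h2; rewrite linearN/= !innerNr => h2.
  by apply/eqP; rewrite eq_le subr_le0 h1 subr_ge0 -lerN2 h2.
have {}yz : y = adjoint B (mu0 + P zeta) by rewrite linearD/= -yz addrC subrK.
exists (mu0 + P zeta) => //.
apply/(subdifferential0P (decomp_proper dec) (decomp_sublinear dec)) => z.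
have [nN _] := decomp_proper dec.
move: (nN z); case E : (theta z) => [a| |] // _; last by rewrite leey.
have [w Pw] := proj_derivative_surjective z.
have Pr : P (B w - z) = 0 by rewrite linearB/= Pw subrr.
have za : (theta z <= a%:E)%E by rewrite E.
have := theta_shift Cmu0 Pr za; rewrite addrC subrK => /(subgradient_bound gy).
rewrite {1}yz adjointP innerDl innerBr (innerDl _ _ z).
have := inner_proj_ker (projK zeta) Pr; rewrite innerBr lee_fin.
lra.
Qed.

Hypothesis g_convex : convex_efun g.

(** Xi is differentiable at u, so mu supports g there to first order;
    convexity turns this local inequality into a global one. *)
Lemma subgradient_of_multiplier u mu : O u -> subdifferential theta (Xi u) mu ->
  subdifferential g u (adjoint ('d Xi u) mu).
Proof.
move=> Ou' [tf tmu].
have gf0 := decomp_fin_num dec.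
have gu : g u = (fine (g ubar) + fine (theta (Xi u)))%:E.
  by rewrite (decomp_eq dec Ou') -{1}(fineK gf0) -{1}(fineK tf).
have gf : g u \is a fin_num by rewrite gu.
suff hb v b : (g v <= b%:E)%E ->
    fine (g u) + inner (adjoint ('d Xi u) mu) (v - u) <= b.
  split=> // v; rewrite -(fineK gf) -EFinD.
  case E : (g v) => [b| |]; [|by rewrite leey|].
    by rewrite lee_fin; apply: hb; rewrite E.
  set c := _ + _; have := hb v (c - 1); rewrite E leNye -/c => /(_ isT).
  by rewrite lerDl oppr_ge0 leNgt ltr01.
move=> vb; rewrite -subr_ge0; apply/ler_addgt0Pl => eps eps0.
set d := v - u; pose k := (`|mu| + 1) * (`|d| + 1).
have d10 : 0 < `|d| + 1 by rewrite ltr_wpDl.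
have k0 : 0 < k by rewrite mulr_gt0// ltr_wpDl.
have ek0 : 0 < eps / k by rewrite divr_gt0.
have [r r0 hr] : exists2 r : R, 0 < r & forall z, `|z - u| < r ->
    O z /\ `|Xi z - Xi u - 'd Xi u (z - u)| <= eps / k * `|z - u|.
  apply/nbhs_normrP; near=> z; split; first by near: z; exact: open_nbhs_nbhs.
  by near: z; exact: (differentiableE (C1_on_diff C2Xi.1 Ou') ek0).
pose t := Num.min (r / (`|d| + 1)) 1 / 2.
have m0 : 0 < Num.min (r / (`|d| + 1)) 1 by rewrite lt_min divr_gt0/=.
have t0 : 0 < t by rewrite divr_gt0.
have : t < Num.min (r / (`|d| + 1)) 1 by rewrite /t ltr_pdivrMr// ltr_pMr// ltr1n.
rewrite lt_min ltr_pdivlMr// => /andP[tr t1].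
have zu : u + t *: d - u = t *: d by rewrite addrC addKr.
have nz : `|u + t *: d - u| = t * `|d| by rewrite zu normrZ gtr0_norm.
have [|Oz dz] := hr (u + t *: d).
  by rewrite nz (le_lt_trans _ tr)// ler_pM2l// lerDl.
have t01 : 0 < t < 1 by rewrite t0.
have gu' : (g u <= (fine (g u))%:E)%E by rewrite fineK.
have := convex_efun_segment g_convex t01 gu' vb; rewrite -/d.
have tz : ((fine (theta (Xi u)) + inner mu (Xi (u + t *: d) - Xi u))%R%:E <=
           theta (Xi (u + t *: d)%R))%E.
  by rewrite EFinD fineK.
rewrite (decomp_eq dec Oz) -{1}(fineK gf0) => h.
have := le_trans (leeD2l (fine (g ubar))%:E tz) h.
rewrite gu /= -EFinD lee_fin addrA zu in dz * => h1.
rewrite -(ler_pM2l t0) mulr0.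
have := inner_le (- mu) (Xi (u + t *: d) - Xi u - 'd Xi u (t *: d)).
rewrite innerNl innerBr linearZ/= innerZr normrN adjointP.
move: dz; rewrite linearZ/= normrZ gtr0_norm// => dz.
have h2 : `|mu| * `|Xi (u + t *: d) - Xi u - t *: 'd Xi u d| <= t * eps.
  apply: (@le_trans _ _ ((`|mu| + 1) * (eps / k * (t * (`|d| + 1))))).
    rewrite ler_pM// ?lerDl// (le_trans dz)// ler_pM2l// ler_pM2l// lerDl.
    by [].
  rewrite le_eqVlt; apply/orP; left; apply/eqP; rewrite /k; field.
  by rewrite !gt_eqF// ltr_wpDl.
by move: h2 h1; exact: first_order_bound.
Unshelve. all: by end_near. Qed.

Lemma multipliers_singleton y : subdifferential g ubar y ->
  exists mu, multipliers theta Xi ubar y = [set mu].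
Proof.
move=> /subgradient_lift[mu Cmu Bmu]; exists mu; rewrite /multipliers Xi0.
rewrite eqEsubset; split=> [nu [Bnu Cnu]|nu ->] //=.
apply/eqP; rewrite -subr_eq0; apply/eqP; apply: decomp_nondeg.
  exact: parallel_subspace_sub.
by rewrite linearB/= Bnu Bmu subrr.
Qed.

Lemma theta_subgradient mu z : C mu -> P z = 0 -> subdifferential theta z mu.
Proof.
move=> Cmu Pz; rewrite /subdifferential /= (theta_lineality Cmu Pz); split=> // v.
rewrite -EFinD innerBr addrC subrK.
exact: (subdifferential0P (decomp_proper dec) (decomp_sublinear dec) mu).1.
Qed.

Variables (ybar : Y) (mubar : Z).
Hypotheses (Cmubar : C mubar) (Bmubar : adjoint B mubar = ybar).
Hypothesis ybar_ri : relative_interior (subdifferential g ubar) ybar.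

(** The adjoint B^* is injective on the directions of C, so it carries the
    relative interior of the subdifferential back to C. *)
Lemma multiplier_interior : exists2 del : R, 0 < del &
  forall zeta, `|P zeta| < del -> C (mubar + P zeta).
Proof.
have [_ /nbhs_normrP[r r0 hr]] := ybar_ri.
have cB : continuous (adjoint B) by exact: fd_linear_continuous.
have [M M0 hM] := linear_lipschitz cB.
exists (r / M) => [|zeta Pz]; first exact: divr_gt0.
have gC nu : C nu -> subdifferential g ubar (adjoint B nu).
  by move=> Cnu; apply: subgradient_of_multiplier => //; rewrite Xi0.
have [a ha [b hb ab]] := proj_mem zeta.
have aff : affine_hull (subdifferential g ubar) (adjoint B (mubar + P zeta)).
  rewrite -ab -[a - b]scale1r; apply: (affine_hull_image gC).
  by apply: affine_hull_shift => //; exact: affine_hull_sub.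
have [|nu Cnu Bnu] := subgradient_lift (hr _ _ aff).
  rewrite linearD/= Bmubar addrC addKr (le_lt_trans (hM _))//.
  by rewrite mulrC -ltr_pdivlMr.
suff <- : nu = mubar + P zeta by [].
apply/eqP; rewrite -subr_eq0; apply/eqP; apply: decomp_nondeg.
  have sL := parallel_subspace_linear decomp_nonempty.
  rewrite opprD addrA -[nu - mubar](be (parallel_subspace_sub Cnu Cmubar)) -linearB.
  exact: proj_mem.
by rewrite linearB/= Bnu subrr.
Qed.

Local Notation K := (critical_cone g ubar ybar).

(** The difference quotients at directions v close to w are at least <y, v>. *)
Lemma subgradient_le_subderivative y w : subdifferential g ubar y ->
  ((inner y w)%:E <= subderivative g ubar w)%E.
Proof.
move=> [gf hy]; rewrite /subderivative limf_einfE; apply/lee_addgt0Pr => eps eps0.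
rewrite -leeBlDr// -EFinB; apply: le_ereal_sup_tmp.
pose V := [set p : R * Y | 0 < p.1 /\ inner y w - eps <= inner y p.2].
exists (ereal_inf [set ((g (ubar + p.1 *: p.2)%R - g ubar) * (p.1^-1)%:E)%E | p in V]).
  exists V => //; exists ([set t | 0 < t], [set v | inner y w - eps <= inner y v]) => //=.
  split; first exact: nbhs_right_gt.
  have cy : continuous (inner y) by exact: fd_linear_continuous.
  have /cvgrPdist_le/(_ _ eps0) := cy w.
  by apply: filterS => v; rewrite ler_distlC => /andP[].
apply: le_ereal_inf_tmp => _ [[t v] [/= t0 wv] <-].
have := hy (ubar + t *: v); rewrite addrAC subrr add0r innerZr.
rewrite -(fineK gf); case: (g (ubar + _)) => [s| |] //.
  rewrite -EFinD -EFinB -EFinM !lee_fin => h; rewrite (le_trans wv)//.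
  by rewrite ler_pdivlMr// mulrC lerBrDl.
by rewrite addye// gt0_mulye ?leey// lte_fin invr_gt0.
Qed.

(** Along tangent_points, g equals g ubar + <mubar, Xi u>, and <mubar, B w> is
    <ybar, w>. *)
Lemma subderivative_tangent w : P (B w) = 0 ->
  (subderivative g ubar w <= (inner ybar w)%:E)%E.
Proof.
move=> Pw; have gf := decomp_fin_num dec.
rewrite /subderivative limf_einfE; apply: ge_ereal_sup => _ [V [[A W] /= [A0 Ww] AW] <-].
apply/lee_addgt0Pr => eps eps0.
have [d d0 dA] : exists2 d : R, 0 < d & forall t, 0 < t < d -> A t.
  have /nbhs_normrP[d d0 dA] : nbhs (0 : R) [set t | 0 < t -> A t] by exact: A0.
  exists d => // t /andP[t0 td]; apply: dA => //.
  by rewrite subr0 gtr0_norm.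
have [r r0 rW] := (nbhs_normrP _ _).1 Ww.
pose e1 := Num.min (r / 2) (eps / (`|mubar| + 1)).
have m10 : 0 < `|mubar| + 1 by rewrite ltr_wpDl.
have e10 : 0 < e1 by rewrite lt_min !divr_gt0.
have [t [u [/andP[t0 td] Ou' ut Pr rt]]] := tangent_points w e10 d0.
pose w' := t^-1 *: (u - ubar).
have tw' : ubar + t *: w' = u by rewrite scalerA mulfV ?gt_eqF// scale1r addrC subrK.
have Vt : V (t, w').
  apply: AW; split => /=; first by apply: dA; rewrite t0.
  apply: rW; rewrite -[w](scalerK (a := t)) ?gt_eqF// -scalerBr normrZ gtr0_norm ?invr_gt0//.
  rewrite ltr_pdivrMl// (le_lt_trans ut)// mulrC ltr_pM2l// gt_min.
  by rewrite ltr_pdivrMr// ltr_pMr// ltr1n.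
apply: (@le_trans _ _ ((g (ubar + t *: w')%R - g ubar) * (t^-1)%:E)%E).
  by apply: ereal_inf_lbound; exists (t, w').
have PXi : P (Xi u) = 0.
  by rewrite -(subrK (t *: B w) (Xi u)) linearD/= Pr add0r [P (t *: _)]linearZ/= Pw scaler0.
have gu : (g u = (fine (g ubar) + inner mubar (Xi u))%:E).
  by rewrite (decomp_eq dec Ou') (theta_lineality Cmubar PXi) -{1}(fineK gf).
rewrite tw' gu -{2}(fineK gf) -EFinB -EFinM -EFinD lee_fin addrAC subrr add0r.
rewrite ler_pdivrMr// -(subrK (t *: B w) (Xi u)) innerDr innerZr -adjointP Bmubar.
rewrite mulrDl addrC mulrC lerD2l (le_trans (inner_le _ _))//.
apply: (@le_trans _ _ ((`|mubar| + 1) * (e1 * t))).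
  by rewrite ler_pM// lerDl.
rewrite mulrA ler_pM2r// mulrC -ler_pdivlMr// ge_min lexx orbT //.
Qed.

(** If P (B w) <> 0, moving mubar a little along P (B w) stays in C and gives a
    subgradient y of g with <y, w> larger than <ybar, w>, so the subderivative at w
    is larger too. *)
Lemma critical_coneP w : K w <-> P (B w) = 0.
Proof.
have gy : subdifferential g ubar ybar.
  by rewrite -Bmubar; apply: subgradient_of_multiplier => //; rewrite Xi0.
split=> [Kw|Pw]; last first.
  by apply/eqP; rewrite eq_le (subgradient_le_subderivative w gy) (subderivative_tangent Pw).
have [del del0 hdel] := multiplier_interior.
apply/eqP; rewrite -normr_le0 leNgt; apply/negP => Pw0.
pose s := del / 2 / `|P (B w)|; have s0 : 0 < s by rewrite !divr_gt0.
have Cs : C (mubar + P (s *: B w)).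
  apply: hdel; rewrite linearZ/= normrZ gtr0_norm// /s divfK ?gt_eqF//.
  by rewrite ltr_pdivrMr// ltr_pMr// ltr1n.
have gs : subdifferential g ubar (adjoint B (mubar + P (s *: B w))).
  by apply: subgradient_of_multiplier => //; rewrite Xi0.
have := subgradient_le_subderivative w gs; rewrite -Kw lee_fin.
rewrite linearD/= Bmubar innerDl adjointP gerDl linearZ/= innerZl.
rewrite -[P (B w)]projK inner_projection innerxx leNgt.
by rewrite mulr_gt0// exprn_gt0.
Qed.

(** Near (ubar, ybar) the subgradients form a C1 manifold over Y, through the
    map (u, y) |-> rho u + y; U is a proximal map of g. *)
Lemma local_prox : exists rho N (U : Y -> Y),
  [/\ 0 < rho, open N, N (rho *: ubar + ybar), C1_on N U &
    U (rho *: ubar + ybar) = ubar] /\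
  [/\ forall q, N q -> subdifferential g (U q) (q - rho *: U q),
    forall du zeta, P (B du) = 0 ->
      'd U (rho *: ubar + ybar) (rho *: du + H mubar du + adjoint B (P zeta)) = du &
    forall h, exists du zeta, P (B du) = 0 /\
      h = rho *: du + H mubar du + adjoint B (P zeta)].
Proof.
have [rho [N [s [[rho0 oN Nq0 C1s s0] [sO s1 s2 ds dsK]]]]] := chart mubar.
rewrite Bmubar in Nq0 s0 ds dsK.
have [del del0 hdel] := multiplier_interior.
set q0 := rho *: ubar + ybar in Nq0 s0 ds dsK *.
have il : linear (fun q : Y => (q, 0 : Z)).
  by move=> a x y; rewrite -[RHS]/(a *: x + y, a *: (0 : Z) + 0) scaler0 addr0.
pose i := linear_pack il.
have ci : continuous i by exact: fd_linear_continuous.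
have fdE := prod_finite_dimensional fdY fdZ.
pose N1 := i @^-1` N.
have oN1 : open N1 by apply: open_comp => // x _; exact: ci.
have C1si : C1_on N1 (s \o i).
  by apply: (C1_on_comp fdE oN1 (C1_on_linear oN1 ci) C1s).
have fl : linear (fst : Y * Z -> Y) by [].
have sl : linear (snd : Y * Z -> Z) by [].
have C1U := C1_on_linear_comp (linear_pack fl) fdE oN1 C1si.
have C1z := C1_on_linear_comp (P \o linear_pack sl) fdE oN1 C1si.
pose A := [set q | N1 q /\ `|P (s (q, 0)).2| < del].
have Aq0 : nbhs q0 A.
  have cz := differentiable_continuous (C1_on_diff C1z Nq0).
  have hz : \forall q \near q0, `|P (s (q, 0)).2| < del.
    have /cvgrPdist_lt/(_ _ del0) := cz; apply: filterS => q.
    by rewrite /= s0 /= linear0 sub0r normrN.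
  near=> q; split; first by near: q; exact: open_nbhs_nbhs.
  by near: q; exact: hz.
exists rho, (interior A), (fun q => (s (q, 0)).1); split; split.
- exact: rho0.
- exact: open_interior.
- exact: Aq0.
- apply: C1_on_sub C1U => q /nbhs_singleton[]; exact.
- by rewrite s0.
- move=> q /nbhs_singleton[Nq zq]; set u := (s (q, 0)).1.
  have PXi : P (Xi u) = 0.
    by have := congr1 P (s2 _ Nq); rewrite proj_complement /= linear0.
  have -> : q - rho *: u = adjoint ('d Xi u) (mubar + P (s (q, 0)).2).
    by rewrite -[q in LHS](s1 _ Nq) /= addrAC subrr add0r.
  by apply: subgradient_of_multiplier; [exact: sO|apply: theta_subgradient => //; exact: hdel].
- move=> du zeta Pdu; set v := _ + _ + _.
  have dsi : is_diff q0 (s \o i) ('d s (i q0) \o i).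
    have d1 : is_diff q0 i i.
      by apply: DiffDef; [exact: linear_differentiable|exact: diff_lin].
    have d2 : is_diff (i q0) s ('d s (i q0)).
      by apply: DiffDef => //; exact: C1_on_diff C1s Nq0.
    exact: (@is_diff_comp _ _ _ _ _ _ _ _ _ d1 d2).
  have [_ ->] := is_diff_linear_comp (linear_pack fl) fdE dsi.
  have iv : i v = chart_derivative rho mubar (du, P zeta).
    by rewrite /i /= /chart_derivative /= Pdu projK subrr addr0.
  have dsv : 'd s (i q0) (i v) = (du, P zeta) by rewrite iv; exact: ds.
  by rewrite -[LHS]/(('d s (i q0) (i v)).1) dsv.
- move=> h; have := dsK (h, 0); case: ('d s _ (h, 0)) => du dz [e1 e2].
  exists du, dz; split; last by rewrite -[LHS]e1.
  by have := congr1 P e2; rewrite proj_complement linear0.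
Unshelve. all: by end_near. Qed.

End Decomposition.

(** * The KKT system *)

Section LagrangianGradient.
Context {R : realType} {X Y : finDimHilbertType R}.
Variables (phi : X -> R) (Phi : X -> Y).
Hypotheses (phiC2 : C2_on [set: X] phi) (PhiC2 : C2_on [set: X] Phi).

Let fdX := hilbert_finite_dimensional X.
Let fdY := hilbert_finite_dimensional Y.

Lemma C1_on_grad : C1_on [set: X] (grad phi).
Proof.
have oT : open [set: X] by exact: openT.
have [n [b [ob _ bb]]] := orthonormal_basis (@setT_subspace _ X).
have fdR := real_finite_dimensional R.
apply: (C1_on_eq (f := fun x => \sum_i 'd phi x (b i) *: b i) oT).
  move=> x _; apply: inner_inj => v; rewrite [RHS]rieszP inner_suml.
  rewrite -{2}(bb v I) linear_sum; apply: eq_bigr => i _.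
  by rewrite innerZl linearZ/= mulrC.
apply: (C1_on_sum oT) => i.
have sl : linear (fun r : R => r *: b i).
  by move=> a y z; rewrite /= scalerDl scalerA.
exact: (C1_on_linear_comp (linear_pack sl) fdR oT (phiC2.2 (b i))).
Qed.

Lemma grad_lagrangian y x :
  grad (lagrangian phi Phi y) x = grad phi x + adjoint ('d Phi x) y.
Proof.
apply: inner_inj => v; rewrite innerDl adjointP [LHS]rieszP [X in X + _]rieszP.
have dphi : is_diff x phi ('d phi x) by apply: DiffDef => //; exact: C1_on_diff phiC2.1 I.
have dPhi : is_diff x Phi ('d Phi x) by apply: DiffDef => //; exact: C1_on_diff PhiC2.1 I.
by have [_ ->] := is_diffD dphi (is_diff_linear_comp (inner y) fdY dPhi).
Qed.

Lemma grad_lagrangianB y z x : grad (lagrangian phi Phi y) x =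
  grad (lagrangian phi Phi z) x + adjoint ('d Phi x) (y - z).
Proof. by rewrite !grad_lagrangian -addrA -linearD/= addrC [z + _]addrC subrK addrC. Qed.

Lemma C1_on_grad_lagrangian (U : normedModType R) (D : set U) (f : U -> X) (h : U -> Y) :
  open D -> C1_on D f -> C1_on D h ->
  C1_on D (fun p => grad (lagrangian phi Phi (h p)) (f p)).
Proof.
move=> oD C1f C1h.
apply: (C1_on_eq (f := fun p => grad phi (f p) + adjoint ('d Phi (f p)) (h p)) oD).
  by move=> p _; rewrite grad_lagrangian.
apply: (C1_on_add oD).
  by apply: (C1_on_comp fdX oD C1f C1_on_grad).
by apply: (C1_on_adjoint (O := setT) oD C1f C1h).
Qed.

(** The multiplier enters linearly: the gradient is the one at the fixed
    multiplier h p plus an adjoint term that vanishes at p. *)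
Lemma is_diff_grad_lagrangian (U : normedModType R) (f df : U -> X) (h dh : U -> Y) p :
  is_diff p f df -> is_diff p h dh ->
  is_diff p (fun q => grad (lagrangian phi Phi (h q)) (f q))
    (fun v => hess (lagrangian phi Phi (h p)) (f p) (df v)
            + adjoint ('d Phi (f p)) (dh v)).
Proof.
move=> hf hh; set y0 := h p.
have -> : (fun q => grad (lagrangian phi Phi (h q)) (f q)) =
    (grad (lagrangian phi Phi y0) \o f) +
    (fun q => adjoint ('d Phi (f q)) (h q - y0)).
  by apply/funext => q; rewrite (grad_lagrangianB _ y0).
have oT : open [set: X] by exact: openT.
have dG : is_diff (f p) (grad (lagrangian phi Phi y0)) (hess (lagrangian phi Phi y0) (f p)).
  apply: DiffDef => //; apply: (C1_on_diff _ (I : [set: X] (f p))).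
  have ci : continuous (@idfun X) by move=> x; exact: cvg_id.
  exact: (C1_on_grad_lagrangian oT (C1_on_linear oT ci) (C1_on_cst y0 oT)).
have dh' : is_diff p (fun q => h q - y0) dh.
  have := is_diffB hh (is_diff_cst y0 p); rewrite subr0; exact.
have h0 : h p - y0 = 0 by rewrite subrr.
have := is_diffD (@is_diff_comp _ _ _ _ _ _ _ _ _ hf dG)
  (is_diff_adjoint hf dh' (I : [set: X] (f p)) PhiC2 h0).
exact.
Qed.

End LagrangianGradient.

Lemma lipschitz_arith (R : realType) (rho M a b : R) : 0 < rho -> 0 < M ->
  0 <= a -> 0 <= b ->
  a <= (1 + rho * (M + 1) + rho + 1) * (a + b) /\
  rho * ((M + 1) * a) + rho * b + a <= (1 + rho * (M + 1) + rho + 1) * (a + b).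
Proof.
move=> r0 M0 a0 b0.
have c0 : 0 <= rho * (M + 1) by rewrite mulr_ge0 ?addr_ge0 ?ltW.
rewrite mulrA; move: (rho * (M + 1)) c0 => c c0.
have ca := mulr_ge0 c0 a0; have cb := mulr_ge0 c0 b0.
have ra := mulr_ge0 (ltW r0) a0; have rb := mulr_ge0 (ltW r0) b0.
by split; lra.
Qed.

Section ProximalKKT.
Context {R : realType}.
Variables (X Y : finDimHilbertType R) (phi : X -> R) (Phi : X -> Y) (g : Y -> \bar R).
Variables (xbar : X) (ybar : Y) (rho : R) (N : set Y) (U : Y -> Y).
Hypotheses (phiC2 : C2_on [set: X] phi) (PhiC2 : C2_on [set: X] Phi).
Hypothesis KKT_x : grad (lagrangian phi Phi ybar) xbar = 0.
Hypotheses (rho0 : 0 < rho) (oN : open N) (C1U : C1_on N U).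

Local Notation qbar := (rho *: Phi xbar + ybar).
Hypotheses (Nqbar : N qbar) (Uqbar : U qbar = Phi xbar).
Hypothesis gU : forall q, N q -> subdifferential g (U q) (q - rho *: U q).

Let fdX := hilbert_finite_dimensional X.
Let fdY := hilbert_finite_dimensional Y.

(** Both (U q, y) and (u, q - rho U q) belong to monotone graphs, and equality
    of rho u + y on them forces u = U q because of the factor rho > 0. *)
Lemma conjugate_prox u y : N (rho *: u + y) ->
  subdifferential (conjugate g) y u <-> U (rho *: u + y) = u.
Proof.
set q := _ + y => Nq; have gq := subdifferential_conjugate (gU Nq).
split=> [gy|Uq]; last by move: gq; rewrite Uq /q addrAC subrr add0r.
have := subdifferential_monotone gq gy.
have -> : q - rho *: U q - y = - (rho *: (U q - u)).
  by rewrite /q scalerBr opprB addrAC addrK.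
rewrite innerC innerNl innerZl oppr_ge0 pmulr_rle0// => h.
by apply/eqP; rewrite -subr_eq0; apply/eqP/inner_eq0/eqP; rewrite eq_le h inner_ge0.
Qed.

(** The parameter (x, q) stands for the pair of the graph of the KKT map with
    primal point x and multiplier y = q - rho U q; its residual uses U q as the
    subgradient of the conjugate of g at y. *)
Definition kkt_point (e : X * Y) : X * Y := (e.1, e.2 - rho *: U e.2).

Definition kkt_residual (e : X * Y) : X * Y :=
  (grad (lagrangian phi Phi (e.2 - rho *: U e.2)) e.1, U e.2 - Phi e.1).

(** On the graph the subgradient of the conjugate is U q = Phi x + v.2, and
    q = rho U q + y; this recovers the parameter from the pair (p, v). *)
Definition kkt_parameter (p v : X * Y) : X * Y :=
  (p.1, rho *: (Phi p.1 + v.2) + p.2).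

Let D : set (X * Y) := [set: X] `*` N.

Let oD : open D.
Proof. by apply: open_setX => //; exact: openT. Qed.

Let D0 : D (xbar, qbar). Proof. by []. Qed.

Lemma kkt_point0 : kkt_point (xbar, qbar) = (xbar, ybar).
Proof. by rewrite /kkt_point /= Uqbar addrAC subrr add0r. Qed.

Lemma kkt_residual0 : kkt_residual (xbar, qbar) = (0, 0).
Proof. by rewrite /kkt_residual /= Uqbar addrAC subrr add0r KKT_x subrr. Qed.

Let C1fst : C1_on D (fst : X * Y -> X).
Proof. by apply: (C1_on_linear oD) => x; exact: cvg_fst. Qed.

Let C1snd : C1_on D (snd : X * Y -> Y).
Proof. by apply: (C1_on_linear oD) => x; exact: cvg_snd. Qed.

Let C1Usnd : C1_on D (fun e : X * Y => U e.2).
Proof. by apply: (C1_on_comp fdY oD C1snd C1U) => x []. Qed.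

Let C1multiplier : C1_on D (fun e : X * Y => e.2 - rho *: U e.2).
Proof.
have C1r := C1_on_linear_comp (GRing.scale (- rho)) fdY oD C1Usnd.
apply: (C1_on_eq oD _ (C1_on_add oD C1snd C1r)) => e _.
by rewrite /= scaleNr.
Qed.

Lemma C1_on_kkt_point : C1_on D kkt_point.
Proof. exact: (C1_on_pair oD C1fst C1multiplier). Qed.

Lemma C1_on_kkt_residual : C1_on D kkt_residual.
Proof.
apply: (C1_on_pair oD).
  exact: (C1_on_grad_lagrangian phiC2 PhiC2 oD C1fst C1multiplier).
have C1Phi : C1_on D (fun e : X * Y => Phi e.1).
  by apply: (C1_on_comp fdX oD C1fst PhiC2.1).
have C1N := C1_on_linear_comp (@GRing.opp Y) fdY oD C1Phi.
exact: (C1_on_add oD C1Usnd C1N).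
Qed.

Lemma diff_kkt_residual h : 'd kkt_residual (xbar, qbar) h =
  (hess (lagrangian phi Phi ybar) xbar h.1
     + adjoint ('d Phi xbar) (h.2 - rho *: 'd U qbar h.2),
   'd U qbar h.2 - 'd Phi xbar h.1).
Proof.
pose e0 : X * Y := (xbar, qbar).
have c1 : continuous (fst : X * Y -> X) by move=> x; exact: cvg_fst.
have c2 : continuous (snd : X * Y -> Y) by move=> x; exact: cvg_snd.
have d1 : is_diff e0 (fst : X * Y -> X) fst.
  by apply: DiffDef; [exact: linear_differentiable|exact: diff_lin].
have d2 : is_diff e0 (snd : X * Y -> Y) snd.
  by apply: DiffDef; [exact: linear_differentiable|exact: diff_lin].
have dU : is_diff (e0.2) U ('d U qbar).
  by apply: DiffDef => //; exact: C1_on_diff C1U Nqbar.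
have dPhi : is_diff (e0.1) Phi ('d Phi xbar).
  by apply: DiffDef => //; exact: C1_on_diff PhiC2.1 I.
have dU2 := @is_diff_comp _ _ _ _ _ _ _ _ _ d2 dU.
have dP1 := @is_diff_comp _ _ _ _ _ _ _ _ _ d1 dPhi.
have dy := is_diffB d2 (is_diff_linear_comp (GRing.scale rho) fdY dU2).
have dG := is_diff_grad_lagrangian phiC2 PhiC2 d1 dy.
have [_ dE] := is_diff_pair dG (is_diffB dU2 dP1).
transitivity ('d (fun q : X * Y => (grad (lagrangian phi Phi ((snd - (fun z => rho *: (U \o snd) z)) q)) q.1, ((U \o snd) - (Phi \o fst)) q)) e0 h).
  by [].
rewrite dE /= !fctE /= Uqbar.
by have -> : qbar - rho *: Phi xbar = ybar by rewrite addrAC subrr add0r.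
Qed.

Lemma kkt_graphP p v : D (kkt_parameter p v) ->
  KKT_map phi Phi g p v <->
    p = kkt_point (kkt_parameter p v) /\ v = kkt_residual (kkt_parameter p v).
Proof.
case: p v => [x y] [v1 v2] [_ /= Nq]; split.
  move=> [v gv [<- ev2]].
  have vE : v = Phi x + v2 by rewrite -ev2 addrA subrr add0r.
  rewrite vE in gv; have Uq := (conjugate_prox Nq).1 gv.
  rewrite /kkt_point /kkt_residual /kkt_parameter /= Uq.
  rewrite [_ + y - _]addrAC subrr add0r; split=> //.
  by rewrite addrAC subrr add0r.
rewrite /kkt_point /kkt_residual /kkt_parameter /=.
set q := _ + y in Nq *; move=> [[ey] [ev1 ev2]].
have Uq : U q = Phi x + v2 by rewrite ev2 addrC subrK.
exists (Phi x + v2) => /=; first exact/conjugate_prox.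
by rewrite addrA addNr add0r ev1 -ey.
Qed.

Lemma kkt_parameterK e : D e -> kkt_parameter (kkt_point e) (kkt_residual e) = e.
Proof.
case: e => [x q] _; rewrite /kkt_parameter /kkt_point /kkt_residual /=.
by congr (_, _); rewrite [Phi x + _]addrC subrK addrC subrK.
Qed.

Lemma kkt_parameter_lip : exists k : R,
  \forall p \near kkt_point (xbar, qbar) & v \near kkt_residual (xbar, qbar),
  `|kkt_parameter p v - (xbar, qbar)| <=
    k * (`|p - kkt_point (xbar, qbar)| + `|v - kkt_residual (xbar, qbar)|).
Proof.
rewrite kkt_point0 kkt_residual0.
have dPhi := C1_on_diff PhiC2.1 (I : [set: X] xbar).
have [M M0 hM] := fd_linear_bounded ('d Phi xbar) fdX.
have [r r0 hr] := (nbhs_normrP _ _).1 (differentiableE dPhi ltr01).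
exists (1 + rho * (M + 1) + rho + 1).
exists ([set p : X * Y | `|p - (xbar, ybar)| < r], setT) => /=.
  by split; [apply/nbhs_normrP; exists r|exact: filterT].
case=> -[x y] [v1 v2] [/= pr _].
have hx : `|x - xbar| <= `|(x, y) - (xbar, ybar)|.
  by rewrite [leRHS]prod_normE le_max lexx.
have hy : `|y - ybar| <= `|(x, y) - (xbar, ybar)|.
  by rewrite [leRHS]prod_normE le_max lexx orbT.
have hv : `|v2| <= `|(v1, v2) - (0, 0)|.
  by rewrite [leRHS]prod_normE /= !subr0 le_max lexx orbT.
have hP : `|Phi x - Phi xbar| <= (M + 1) * `|x - xbar|.
  rewrite -(subrK ('d Phi xbar (x - xbar)) (Phi x - _)) (le_trans (ler_normD _ _))//.
  by rewrite mulrDl addrC lerD// hr// (le_lt_trans hx pr).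
move: hx hy hv; set a := `|(x, y) - _|; set b := `|(v1, v2) - _| => hx hy hv.
have a0 : 0 <= a by exact: le_trans hx.
have b0 : 0 <= b by exact: le_trans hv.
have [ha hab] := lipschitz_arith rho0 M0 a0 b0.
rewrite prod_normE ge_max; apply/andP; split=> /=.
  exact: le_trans hx ha.
have -> : rho *: (Phi x + v2) + y - qbar =
    rho *: (Phi x - Phi xbar) + rho *: v2 + (y - ybar).
  rewrite opprD addrACA; congr (_ + _).
  by rewrite -scalerBr -scalerDr addrAC.
apply: le_trans hab; apply: (le_trans (ler_normD _ _)); apply: lerD; last exact: hy.
apply: (le_trans (ler_normD _ _)); apply: lerD.
  rewrite normrZ gtr0_norm// ler_pM2l// (le_trans hP)// ler_wpM2l//.
  by rewrite addr_ge0// ltW.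
by rewrite normrZ gtr0_norm// ler_pM2l.
Qed.

End ProximalKKT.

Theorem theorem5p14 (R : realType) (X Y : finDimHilbertType R)
    (phi : X -> R) (Phi : X -> Y) (g : Y -> \bar R)
    (phiC2 : C2_on [set: X] phi) (PhiC2 : C2_on [set: X] Phi)
    (g_convex : convex_efun g)
    (xbar : X) (ybar : Y)
    (KKT_x : grad (lagrangian phi Phi ybar) xbar = 0)
    (KKT_y : subdifferential g (Phi xbar) ybar)
    (ybar_ri : relative_interior (subdifferential g (Phi xbar)) ybar)
    (g_reliable : \forall u \near Phi xbar,
        edom g u -> reliably_C2_decomposable g u)
    (Z : finDimHilbertType R) (O : set Y)
    (theta : Z -> \bar R) (Xi : Y -> Z)
    (g_decomp : C2_decomposition g (Phi xbar) O theta Xi)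
    (g_nondeg : nondegenerate_at (Phi xbar) theta Xi) :
  let ubar := Phi xbar in
  let Psi := KKT_map phi Phi g in
  let K := critical_cone g ubar ybar in
  exists2 mubar : Z, multipliers theta Xi ubar ybar = [set mubar] &
  [<->
    (* (a) *) strongly_metrically_regular Psi (xbar, ybar) (0, 0);
    (* (b) *) metrically_regular Psi (xbar, ybar) (0, 0);
    (* (c) *) strongly_metrically_subregular Psi (xbar, ybar) (0, 0);
    (* (d) *) exists s : X * Y -> X * Y,
      lipschitz_localization (S_KKT phi Phi g) (0, 0) (xbar, ybar) s /\
      exists2 N, open_nbhs (0, 0) N & C1_on N s;
    (* (e) *) forall (w : X) (w' : Y),
      hess (lagrangian phi Phi ybar) xbar w
        - adjoint ('d Phi xbar) w' = 0 ->
      K ('d Phi xbar w) ->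
      orthogonal_complement K
        (w' + hess (fun u => inner mubar (Xi u)) ubar ('d Phi xbar w)) ->
      (w, w') = (0, 0)].

Proof.
move=> ubar Psi K.
have fdE := prod_finite_dimensional (hilbert_finite_dimensional X) (hilbert_finite_dimensional Y).
have Cne := decomp_nonempty g_decomp g_nondeg.
have [n [e [_ eL be]]] := orthonormal_basis (parallel_subspace_linear Cne).
have [mubar mubarE] := multipliers_singleton g_decomp g_nondeg eL be KKT_y.
exists mubar => //.
have [Bmubar] : multipliers theta Xi ubar ybar mubar by rewrite mubarE.
rewrite /= (decomp_eq0 g_decomp) => Cmubar.
have [rho [N [U [[rho0 oN Nq C1U Uq] [gU dU hU]]]]] :=
  local_prox g_decomp g_nondeg eL be g_convex Cmubar Bmubar ybar_ri.
have KP := critical_coneP g_decomp g_nondeg eL be g_convex Cmubar Bmubar ybar_ri.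
rewrite -/ubar -/K in KP.
set q0 := rho *: ubar + ybar in Nq Uq dU.
pose e0 : X * Y := (xbar, q0).
have oD : open ([set: X] `*` N) by apply: open_setX => //; exact: openT.
have D0 : ([set: X] `*` N) e0 by [].
have C1a : C1_on ([set: X] `*` N) (kkt_point rho U) by exact: C1_on_kkt_point.
have C1b := C1_on_kkt_residual rho phiC2 PhiC2 oN C1U.
have graphP := @kkt_graphP _ _ _ phi Phi g rho N U rho0 gU.
have parK := @kkt_parameterK _ _ _ phi Phi rho N U.
have [k par_lip] := kkt_parameter_lip PhiC2 KKT_x rho0 Uq.
have a0 : kkt_point rho U e0 = (xbar, ybar) := kkt_point0 Uq.
have b0 : kkt_residual phi Phi rho U e0 = (0, 0) := kkt_residual0 KKT_x Uq.
have mem0 : Psi (xbar, ybar) (0, 0).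
  by have := smooth_graph_mem graphP parK D0; rewrite a0 b0.
have dres := diff_kkt_residual phiC2 PhiC2 C1U Nq Uq.
have loc := injective_derivative_localization fdE oD D0 C1a C1b graphP parK par_lip.
have subreg := subregular_injective_derivative oD D0 C1a C1b graphP parK par_lip.
have reg := regular_injective_derivative fdE oD D0 C1b graphP parK par_lip.
rewrite -/e0 a0 b0 in loc subreg reg.
pose inj := forall h, 'd (kkt_residual phi Phi rho U) e0 h = 0 -> h = 0.
pose e_ := forall (w : X) (w' : Y),
  hess (lagrangian phi Phi ybar) xbar w - adjoint ('d Phi xbar) w' = 0 ->
  K ('d Phi xbar w) ->
  orthogonal_complement K
    (w' + hess (fun u => inner mubar (Xi u)) ubar ('d Phi xbar w)) ->
  (w, w') = (0, 0).
(* Every h in Y is rho du + H du + B^* P zeta with P (B du) = 0 and H the Hessian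
   of <mubar, Xi>, and U has derivative du along it.  For a kernel vector (w, h)
   of the derivative of the residual this gives du = Phi'(xbar) w, and
   w' = rho du - h solves the system of (e). *)
have injP : inj <-> e_.
  split=> [ij w w' ew /KP Kw orth|he [w h]].
    have [zeta ez] := normal_of_kernel (fun v hv => orth v ((KP v).2 hv)).
    have hd : 'd U q0 (rho *: 'd Phi xbar w - w') = 'd Phi xbar w.
      rewrite -[RHS](dU _ (- zeta) Kw); congr ('d U q0 _).
      rewrite [orthogonal_projection e (- zeta)]linearN [adjoint _ (- _)]linearN/= -ez.
      by rewrite opprD addrACA subrr addr0.
    have wh0 : (w, rho *: 'd Phi xbar w - w') = 0 :> X * Y.
      apply: ij; rewrite dres /= hd subrr addrAC subrr add0r linearN/=.
      by rewrite ew.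
    case: wh0 => w0; rewrite w0 linear0 scaler0 sub0r => /eqP.
    by rewrite oppr_eq0 => /eqP ->.
  rewrite dres => -[/= e1 e2].
  have [du [zeta [Pdu hE]]] := hU h.
  have dUh : 'd U q0 h = du by rewrite hE dU.
  have wdu : 'd Phi xbar w = du.
    by apply/eqP; rewrite eq_sym -subr_eq0 -dUh e2.
  rewrite dUh in e1.
  have wh0 : (w, rho *: du - h) = (0, 0).
    apply: he => [||v /KP Pv]; last 1 first.
    + rewrite wdu hE -[rho *: du + _ + _]addrA opprD addrA subrr add0r.
      rewrite opprD addrAC addNr add0r.
      by rewrite innerNl adjointP inner_projection Pv inner0r oppr0.
    + by rewrite -linearN/= opprB.
    + by rewrite wdu; apply/KP.
  case: wh0 => w0; rewrite -wdu w0 linear0 scaler0 sub0r => /eqP.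
  by rewrite oppr_eq0 => /eqP ->.
have ba : inj -> strongly_metrically_regular Psi (xbar, ybar) (0, 0).
  by move=> /loc[s [sl _]]; exists s.
have fdEa : e_ -> strongly_metrically_regular Psi (xbar, ybar) (0, 0).
  by move=> /injP.
tfae.
- exact: strong_regularity_regularity.
- by move=> /reg/injP/fdEa; exact: strong_regularity_subregularity.
- by move=> /subreg/loc.
- by move=> [s [sl _]]; apply/injP/subreg/strong_regularity_subregularity => //; exists s.
- exact: fdEa.
Qed.
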